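(* Let $G$ be a graph and let $f\colon G\to G$ be a pure mixing map. Then there exist a graph $G'$, a pure mixing map $g\colon G'\to G'$, and a continuous surjection $\pi\colon G'\to G$ such that: (1) The map $f$ is a factor of $g$ via $\pi$, that is, $\pi\circ g=f\circ\pi$. Moreover, $\pi$ is one-to-one on $G'\setminus \mathcal{I}(g)$ and $\pi(\mathcal{I}(g))=\mathcal{I}(f)$. (2) If $e\in\mathcal{I}(g)$ then $e$ is an endpoint of $G'$ and $g^{-1}(e)=\{e'\}$ for some $e'\in\mathcal{I}(g)$. Moreover, $\mathcal{I}(g)$ has less than $\Lambda(G)$ elements.
   Context: A (topological) graph is a compact connected metric space homeomorphic to the geometric carrier of a one-dimensional simplicial complex (a triangulation of the graph); it is endowed with the taxicab metric (distance = length of a shortest arc joining two points). A subgraph of $G$ is a subset of $G$ that is itself a graph, equivalently a nondegenerate subcontinuum of $G$; a single point is not a subgraph. An endpoint of $G$ is a point of valence $1$. All maps are continuous. A map $f\colon G\to G$ is mixing if for any nonempty open $U,V\subset G$ there is $N>0$ with $f^n(U)\cap V\neq\emptyset$ for all $n\ge N$; it is exact if for every nonempty open $U\subset G$ there is $n\ge 0$ with $f^n(U)=G$; it is pure mixing if it is mixing but not exact. For a map $f$ of a graph $G$, the set of inaccessible points of $f$ is $$\mathcal{I}(f)=G\setminus\bigcap_{J}\bigcup_{k=0}^{\infty}\operatorname{int} f^k(J),$$ where $J$ ranges over all subgraphs of $G$ (similarly for $g$ on $G'$). The disconnecting number $D^s(G)$ of a graph $G$ is the least $n>0$ such that for every subset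 $D\subset G$ of cardinality $n$ the set $G\setminus D$ is not connected. $\Lambda(G)$ denotes the maximal disconnecting number among all subgraphs of $G$. *)

(* Defs.v *)
From HB Require Import structures.
From mathcomp Require Import all_boot all_order all_algebra.
From mathcomp Require Import all_classical all_reals.
From mathcomp Require Import topology normedtype.

Set Implicit Arguments.
Unset Strict Implicit.
Unset Printing Implicit Defensive.

Import Order.TTheory GRing.Theory Num.Theory.
Import numFieldNormedType.Exports.

Local Open Scope classical_set_scope.
Local Open Scope card_scope.
Local Open Scope ring_scope.

Section SimplicialComplex.
Context (R : realType) (n : nat).

(* An abstract finite simplicial complex on vertices taken from 'I_n.  Indices
   i with [set i] \notin K are not vertices of the complex. *)
Definition simplicial_complex (K : {set {set 'I_n}}) : Prop :=
  (forall s, s \in K -> s != finset.set0) /\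
  (forall s t : {set 'I_n},
     s \in K -> t \subset s -> t != finset.set0 -> t \in K).

Definition one_dimensional (K : {set {set 'I_n}}) : Prop :=
  (forall s, s \in K -> (#|s| <= 2)%N) /\ (exists2 s, s \in K & #|s| = 2%N).

(* The geometric carrier, in barycentric coordinates. *)
Definition carrier (K : {set {set 'I_n}}) : set 'rV[R]_n :=
  [set x : 'rV[R]_n |
    [/\ forall i, 0 <= x ord0 i,
        \sum_(i < n) x ord0 i = 1
      & [set i | x ord0 i != 0]%SET \in K]].

End SimplicialComplex.

Definition homeomorphism (X Y : topologicalType) (A : set X) (B : set Y)
    (h : X -> Y) : Prop :=
  set_bij A B h /\ {within A, continuous h} /\
  exists k : Y -> X, {within B, continuous k} /\ {in A, cancel h k}.

Section Graph.
Context (R : realType) (T : metricType R).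

(* Graphs are compact, so only finite complexes are needed. *)
Definition triangulation (A : set T) (n : nat) (K : {set {set 'I_n}})
    (h : 'rV[R]_n -> T) : Prop :=
  [/\ simplicial_complex K, one_dimensional K
    & homeomorphism (@carrier R n K) A h].

(* Applied both to the full set of a space and to its subsets; a single point
   is not a graph since the complex has at least one edge. *)
Definition is_graph (A : set T) : Prop :=
  [/\ compact A, connected A
    & exists (n : nat) (K : {set {set 'I_n}}) (h : 'rV[R]_n -> T),
        triangulation A K h].

(* The valence of x in A is the number of edges at x in a triangulation of A
   having x as a vertex; it does not depend on the triangulation. *)
Definition has_valence (A : set T) (x : T) (v : nat) : Prop :=
  exists (n : nat) (K : {set {set 'I_n}}) (h : 'rV[R]_n -> T) (i : 'I_n),
    [/\ triangulation A K h, [set i]%SET \in K, h (delta_mx ord0 i) = x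
      & #|[set s in K | (i \in s) && (#|s| == 2%N)]%SET| = v].

Definition endpoint (A : set T) (x : T) : Prop := has_valence A x 1.

Definition disconnects (A : set T) (n : nat) : Prop :=
  forall D : set T, D `<=` A -> D #= `I_n -> ~ connected (A `\` D).

(* D^s(A) = n *)
Definition disconnecting_number (A : set T) (n : nat) : Prop :=
  [/\ (0 < n)%N, disconnects A n
    & forall m : nat, (0 < m)%N -> disconnects A m -> (n <= m)%N].

(* Lambda(A) = L *)
Definition max_disconnecting_number (A : set T) (L : nat) : Prop :=
  (exists B : set T, [/\ B `<=` A, is_graph B & disconnecting_number B L]) /\
  (forall (B : set T) (m : nat), B `<=` A -> is_graph B ->
     disconnecting_number B m -> (m <= L)%N).

Definition mixing (f : T -> T) : Prop :=
  forall U V : set T, open U -> open V -> U !=set0 -> V !=set0 ->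
    exists2 N : nat, (0 < N)%N &
      forall n : nat, (N <= n)%N -> (iter n f @` U) `&` V !=set0.

Definition exact_map (f : T -> T) : Prop :=
  forall U : set T, open U -> U !=set0 ->
    exists n : nat, iter n f @` U = [set: T].

Definition pure_mixing (f : T -> T) : Prop := mixing f /\ ~ exact_map f.

Definition inaccessible (f : T -> T) : set T :=
  ~` \bigcap_(J in [set J : set T | is_graph J])
       \bigcup_(k in [set: nat]) (iter k f @` J)°.

End Graph.

(* Main.v *)
Require Import Defs.
From HB Require Import structures.
From mathcomp Require Import all_boot all_order all_algebra.
From mathcomp Require Import all_classical all_reals.
From mathcomp Require Import topology normedtype.
From mathcomp Require Import lra zify.

(* The interiors of the iterates of a small arc J0 exhaust G up to finitely many
   germs of edges.  The gap lemma drives the argument: a connected set missing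
   two points of an edge either avoids what is between them or lies between
   them.  Among three disjoint arcs of one edge, a large iterate of any
   nondegenerate connected set therefore misses at most one, and bookkeeping of
   the covering times yields an arc J0 contained in all large iterates of every
   nondegenerate connected set; then C_n = f^n(J0) is eventually increasing and
   controls all inaccessible points.  Again by the gap lemma, an edge has at most
   one interior parameter that no C_n covers on both sides; cutting the edges
   there, only germs at vertices can remain uncovered.  G' is obtained by
   detaching every uncovered germ from its vertex, so that it gets a new endpoint
   of its own; f lifts along the C_n, and near a new endpoint the lift has a limit
   because its image is connected and cannot cross a germ.  Shrinking the detached
   germs embeds G' in G, and removing any of the new endpoints leaves it
   connected; this bounds their number by the disconnecting number of a subgraph. *)

Set Implicit Arguments.
Unset Strict Implicit.
Unset Printing Implicit Defensive.

Import Order.TTheory GRing.Theory Num.Theory.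
Import numFieldNormedType.Exports.

Local Open Scope classical_set_scope.
Local Open Scope card_scope.
Local Open Scope ring_scope.

(** * Arc systems *)

(** Inaccessibility belongs to germs rather than to points: a vertex may have covered and uncovered
    germs at once, so single germs are split off, and several new endpoints may lie over one
    inaccessible point. The splitting is harmless because each [C n] misses a whole punctured
    initial piece of every uncovered germ. The preimage of [C n] without the new endpoints is
    therefore compact, [pi] maps it bijectively onto [C n], and the lift of [f] gets its continuity
    from these compact sets. Three test arcs are the right number: if at most one is missed at each
    large time, some arc is covered at two consecutive times, and two consecutive return times
    generate all large ones. The lift permutes the new endpoints. Points close to a new endpoint are
    covered late, so their preimages are covered late as well and lie in short uncovered germs; one
    germ cannot tend to two endpoints, and there are finitely many germs. *)

Lemma seg_compact (R : realType) (s t : R) : compact [set r : R | s <= r <= t].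
Proof.
rewrite (_ : [set _ | _] = [set` `[s, t]]); last by rewrite set_itvcc.
exact: segment_compact.
Qed.

Lemma seg_closed (R : realType) (s t : R) : closed [set r : R | s <= r <= t].
Proof. by apply: compact_closed; [exact: Rhausdorff|exact: seg_compact]. Qed.

Lemma gap_closed (R : realType) (s t : R) :
  closed (~` [set r : R | s < r < t]).
Proof.
apply: open_closedC.
rewrite (_ : [set _ | _] = [set` `]s, t[]); last by rewrite set_itvoo.
exact: interval_open.
Qed.

Lemma convex_connected (R : realType) (E : set R) :
  (forall x y z : R, E x -> E y -> x <= z <= y -> E z) -> connected E.
Proof. by move=> h; apply/connected_intervalP => x y Ex Ey z; exact: h. Qed.

Lemma connected_image (X Y : topologicalType) (f : X -> Y) (E : set X) :
  continuous f -> connected E -> connected (f @` E).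
Proof.
move=> cf cE; apply: connected_continuous_connected => //.
exact: continuous_subspaceT.
Qed.

Lemma connected_clopen (X : topologicalType) (C O F : set X) :
  connected C -> open O -> closed F -> C `&` O = C `&` F ->
  C `&` O !=set0 -> C `<=` O.
Proof.
move=> cC oO cF e n0 x Cx.
have: (C `&` O) x by rewrite (cC (C `&` O)) //; [exists O | exists F].
by case.
Qed.

Section ArcSystems.
Context (R : realType).

(* Arcs [p a] parametrised by [0, 1] that meet only at endpoints; [v a b] names
   the vertex at the end [b] of the arc [a], so loops and multiple arcs are
   allowed. *)
Record arc_system (X : topologicalType) (A W : finType) (v : A -> bool -> W)
    (p : A -> R -> X) : Prop := ArcSystem {
  arc_cont : forall a, continuous (p a);
  arc_vertex : forall a b (i j : bool), v a i = v b j -> p a i%:R = p b j%:R;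
  arc_inj : forall a b t s, 0 <= t <= 1 -> 0 <= s <= 1 -> p a t = p b s ->
    (a = b /\ t = s) \/
    exists i j : bool, [/\ t = i%:R, s = j%:R & v a i = v b j] }.

Definition arc_union (X : Type) (A : finType) (p : A -> R -> X) : set X :=
  [set x | exists a (t : R), 0 <= t <= 1 /\ x = p a t].

Definition germ (X : Type) (A : finType) (p : A -> R -> X) (e : A * bool)
  (t : R) : X := p e.1 (if e.2 then 1 - t else t).

Definition vend (A W : finType) (v : A -> bool -> W) (e : A * bool) : W :=
  v e.1 e.2.

(** A finite union of compact images. Most closed sets below are of this form, and open
    neighbourhoods arise as their complements. *)
Lemma closed_arcs (X : topologicalType) (A : finType) (p : A -> R -> X)
    (K : A -> set R) : hausdorff_space X -> (forall a, continuous (p a)) ->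
  (forall a, closed (K a)) ->
  closed [set x | exists a (t : R), [/\ 0 <= t <= 1, K a t & x = p a t]].
Proof.
move=> hX pc Kc.
rewrite (_ : [set _ | _] =
  \bigcup_(a in [set: A]) (p a @` ([set r : R | 0 <= r <= 1] `&` K a))).
  apply: closed_bigcup => [|a _]; first exact: finite_finset.
  apply: compact_closed => //.
  apply: continuous_compact; first exact: continuous_subspaceT.
  by apply: compact_closedI => //; exact: seg_compact.
apply/seteqP; split=> x /=.
  by move=> [a [t [t01 Kt ->]]]; exists a => //; exists t.
by move=> [a _ [t [t01 Kt] <-]]; exists a, t.
Qed.

Lemma arc_union_compact (X : topologicalType) (A : finType) (p : A -> R -> X) :
  (forall a, continuous (p a)) -> compact (arc_union p).
Proof.
move=> pc.
rewrite (_ : arc_union p =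
  \big[setU/set0]_(a <- enum A) (p a @` [set r : R | 0 <= r <= 1])).
  apply: bigsetU_compact => a _; apply: continuous_compact.
    exact: continuous_subspaceT.
  exact: seg_compact.
rewrite -bigcup_seq; apply/seteqP; split=> x /=.
  by move=> [a [t [t01 ->]]]; exists a; [rewrite /= mem_enum|exists t].
by move=> [a _ [t t01 <-]]; exists a, t.
Qed.

(** Pasting lemma: the preimage of a closed set is a finite union of arc pieces, closed by
    [closed_arcs]. The point of [Y] serves as value off the arcs. *)
Lemma glue_arcs (X Y : topologicalType) (A W : finType) (v : A -> bool -> W)
    (p : A -> R -> X) (q : A -> R -> Y) : hausdorff_space X ->
  arc_system v p -> (forall a, continuous (q a)) ->
  (forall a b (i j : bool), v a i = v b j -> q a i%:R = q b j%:R) ->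
  (exists y : Y, True) ->
  exists h : X -> Y, {within arc_union p, continuous h} /\
    forall a t, 0 <= t <= 1 -> h (p a t) = q a t.
Proof.
move=> hX ps qc qv [y0 _].
have ex x : exists y, forall a t, 0 <= t <= 1 -> x = p a t -> y = q a t.
  have [[a [t [t01 ->]]]|no] := pselect (arc_union p x); last first.
    by exists y0 => a t t01 xE; case: no; exists a, t.
  exists (q a t) => b s s01 e.
  by case: (arc_inj ps t01 s01 e) => [[-> ->//]|[i [j [-> -> /qv]]]].
have [h hE] := choice ex.
have hp a t : 0 <= t <= 1 -> h (p a t) = q a t by move=> t01; exact: hE.
exists h; split=> //.
apply/continuous_closedP => F cF; apply/closed_subspaceP.
exists [set x | exists a (t : R), [/\ 0 <= t <= 1, (q a @^-1` F) t & x = p a t]].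
  apply: closed_arcs => // [|a]; first exact: arc_cont ps.
  exact: (continuous_closedP (q a)).1.
apply/seteqP; split=> x /=.
  move=> [[a [t [t01 qF ->]]] _]; split; last by exists a, t.
  by change (F (h (p a t))); rewrite hp.
move=> [Fx [a [t [t01 xE]]]]; split; last by exists a, t.
by exists a, t; split=> //; change (F (q a t)); rewrite -hp // -xE.
Qed.

Section Spanning.
Context (X : topologicalType) (hX : hausdorff_space X).
Context (A W : finType) (v : A -> bool -> W) (p : A -> R -> X).
Context (ps : arc_system v p) (pT : arc_union p = [set: X]).

Lemma arcP (x : X) : exists a (t : R), 0 <= t <= 1 /\ x = p a t.
Proof. by have : arc_union p x by rewrite pT. Qed.

Lemma arc_inj_inner a b t s : 0 < t < 1 -> 0 <= s <= 1 -> p a t = p b s ->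
  a = b /\ t = s.
Proof.
move=> t01 s01 e.
case: (arc_inj ps _ s01 e) => [|//|[i [j [ti _ _]]]]; first by lra.
by move: t01; rewrite ti; case: i {ti} => /=; rewrite ltxx ?andbF.
Qed.

(** The complement consists of all other arcs and of the rest of [a], since an inner point has only
    one arc and one parameter. *)
Lemma open_subarc a s t : 0 <= s -> t <= 1 -> open (p a @` [set r : R | s < r < t]).
Proof.
move=> s0 t1; rewrite -closedC.
rewrite (_ : ~` _ = [set x | exists b (r : R), [/\ 0 <= r <= 1,
  (if b == a then ~` [set r : R | s < r < t] else setT) r & x = p b r]]).
  apply: closed_arcs => //; first exact: arc_cont ps.
  by move=> b; case: ifP => _; [exact: gap_closed|exact: closedT].
apply/seteqP; split=> x /=.
  have [b [r [r01 ->]]] := arcP x => nx; exists b, r; split=> //.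
  by case: ifP => // /eqP ba /= rst; apply: nx; exists r => //; rewrite ba.
move=> [b [r [r01 Kr ->]]] [r' r'st /= e].
have r'01 : 0 < r' < 1 by lra.
have [ab rr] := arc_inj_inner r'01 r01 e.
by move: Kr; rewrite ab eqxx /= -rr; apply.
Qed.

Lemma closed_subarc a s t : closed (p a @` [set r : R | s <= r <= t]).
Proof.
apply: compact_closed => //; apply: continuous_compact; last exact: seg_compact.
exact/continuous_subspaceT/(arc_cont ps).
Qed.

(** With both ends missing from [C], the open gap and its closure have the same trace on [C], so
    this trace is clopen. *)
Lemma gap_lemma (C : set X) a s t : connected C -> 0 <= s -> t <= 1 ->
  ~ C (p a s) -> ~ C (p a t) -> C `&` p a @` [set r : R | s < r < t] !=set0 ->
  C `<=` p a @` [set r : R | s < r < t].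
Proof.
move=> cC s0 t1 ns nt n0.
apply: (@connected_clopen _ _ _ (p a @` [set r : R | s <= r <= t])) => //.
- exact: open_subarc.
- exact: closed_subarc.
apply/seteqP; split=> x [Cx [r rst e]]; split=> //; exists r => //=.
  by move: rst => /=; lra.
move: rst; rewrite /= !le_eqVlt => /andP[/orP[/eqP sr|->]].
  by case: ns; rewrite sr e.
by move=> /orP[/eqP rt|->//]; case: nt; rewrite -rt e.
Qed.

Lemma arc_closed1 (x : X) : closed [set x].
Proof. by apply: compact_closed => //; exact: compact_set1. Qed.

(** If [C] contained no subarc, points missing from [C] would be dense in every arc; the gap lemma
    would then keep [C] off the inside of all arcs, leaving only finitely many vertices. *)
Lemma connected_subarc (C : set X) x y : connected C -> C x -> C y -> x <> y ->
  exists a (s t : R), [/\ 0 < s, s < t, t < 1 & p a @` [set r : R | s <= r <= t] `<=` C].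
Proof.
move=> cC Cx Cy xy; apply: contrapT => no.
have miss a (s t : R) : 0 <= s -> s < t -> t <= 1 ->
    exists r : R, s < r < t /\ ~ C (p a r).
  move=> s0 st t1; apply: contrapT => nr; apply: no.
  exists a, (s + (t - s) / 3), (s + (t - s) / 3 * 2); split; [lra|lra|lra|].
  move=> z [r /= rst <-]; apply: contrapT => nC; apply: nr; exists r.
  by split => //; lra.
have inner a (t : R) : 0 < t < 1 -> ~ C (p a t).
  move=> t01 Ct.
  have [z Cz zt] : exists2 z, C z & z <> p a t.
    have [xt|/eqP xt] := eqVneq x (p a t); last by exists x.
    by exists y => //; rewrite -xt => /esym.
  have [b [r [r01 zE]]] := arcP z.
  (* [u] and the later [u'] bound a gap around [t] that excludes the parameter of [z] in case [z]
     lies on the same arc. *)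
  have [u [u0 ut nz]] : exists u : R, [/\ 0 <= u, u < t & (b = a -> r < t -> r <= u)].
    have [r_t|t_r] := ltP r t; [exists r|exists 0]; split=> //; lra.
  have [u' [u'1 tu' nz']] :
      exists u : R, [/\ u <= 1, t < u & (b = a -> t < r -> u <= r)].
    have [r_t|t_r] := ltP t r; [exists r|exists 1]; split=> //; lra.
  have [s [sut Cs]] := miss a u t u0 ut (ltac:(lra)).
  have [s' [s'ut Cs']] := miss a t u' (ltac:(lra)) tu' u'1.
  have n0 : C `&` p a @` [set r : R | s < r < s'] !=set0.
    by exists (p a t); split=> //; exists t => //=; lra.
  have s0 : 0 <= s by lra.
  have s'1 : s' <= 1 by lra.
  have [r' /= r's] := gap_lemma cC s0 s'1 Cs Cs' n0 Cz; rewrite zE => e.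
  have [|ab rr] := arc_inj_inner _ r01 e; first by lra.
  subst b r'; have rt : r <> t by move=> rt; apply: zt; rewrite zE rt.
  by move/eqP: rt; rewrite neq_lt => /orP[r_t|t_r];
    [move: (nz erefl r_t)|move: (nz' erefl t_r)]; lra.
(* The ends of arcs other than [x]: a finite, hence closed, set, which makes [x] isolated in [C]. *)
pose F := [set z : X | exists a (t : R), [/\ 0 <= t <= 1,
  ((t = 0 \/ t = 1) /\ p a t <> x) & z = p a t]].
have cF : closed F.
  rewrite (_ : F = \bigcup_(e in [set e : A * bool | p e.1 e.2%:R <> x])
    [set p e.1 e.2%:R]).
    by apply: closed_bigcup => [|e _]; [exact: finite_finset|exact: arc_closed1].
  apply/seteqP; split=> z /=.
    move=> [a [t [_ [[->|->] ne] ->]]].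
      by exists (a, false).
    by exists (a, true).
  move=> [[a b] /= ne ->]; exists a, b%:R; split=> //.
    by case: b {ne}; rewrite ?lexx ler01.
  by split=> //; case: b {ne}; [right|left].
have CF z : C z -> z <> x -> F z.
  move=> Cz zx; have [a [t [t01 zE]]] := arcP z.
  exists a, t; split => //; split; last by rewrite -zE.
  have [t0|t0] := eqVneq t 0; first by left.
  have [t1|t1] := eqVneq t 1; first by right.
  by case: (inner a t); rewrite -?zE // !lt_neqAle eq_sym t0 t1.
have nFx : ~ F x by move=> [a [t [_ [_ ne] e]]]; exact: ne.
have nFy : C `<=` ~` F.
  apply: (connected_clopen cC (closed_openC cF) (@arc_closed1 x)).
    apply/seteqP; split=> z [Cz].
      by move=> nF; split=> //=; apply: contrapT => zx; exact/nF/CF.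
    by move=> /= ->.
  by exists x.
by apply: (nFy y Cy); apply/CF => // /esym.
Qed.

End Spanning.
End ArcSystems.
Arguments arc_cont {R X A W v p} _ _ _ _ _.

Lemma card_II_inj (T : Type) (D : set T) (m : nat) : D #= `I_m ->
  exists2 f : 'I_m -> T, injective f & forall i, D (f i).
Proof.
rewrite card_eq_sym => /card_bijP [f [g fK gK]].
have mi (i : 'I_m) : (i : nat) \in `I_m by rewrite inE /= ltn_ord.
exists (fun i : 'I_m => val (f (exist _ (i : nat) (mi i)))) => [i j /val_inj|i].
  by move/(can_inj fK)/(congr1 val) => /= /val_inj.
exact: set_mem (valP (f _)).
Qed.

Lemma card_range (T : Type) (m : nat) (f : 'I_m -> T) :
  injective f -> range f #= `I_m.
Proof.
move=> fi; rewrite (card_eqr card_II).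
by apply: inj_card_eq => x y _ _; exact: fi.
Qed.

(** * Neighbourhoods of vertices and a bound on disconnecting numbers *)

Section VertexNeighbourhoods.
Context (R : realType) (X : topologicalType) (hX : hausdorff_space X).
Context (A W : finType) (v : A -> bool -> W) (p : A -> R -> X).
Context (ps : arc_system v p) (pT : arc_union p = [set: X]).

Lemma germ0 (Y : Type) (q : A -> R -> Y) e : germ q e 0 = q e.1 e.2%:R.
Proof. by rewrite /germ; case: e => a [] //=; rewrite subr0. Qed.

Lemma germ0_inj e e' : germ p e 0 = germ p e' 0 -> vend v e = vend v e'.
Proof.
rewrite !germ0 => /(arc_inj ps) [||[h1 h2]|[i [j [h1 h2]]]].
- by case: e.2; rewrite ?lexx ler01.
- by case: e'.2; rewrite ?lexx ler01.
- rewrite /vend h1; congr (v _ _); move/eqP: h2.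
  by case: e.2; case: e'.2; rewrite // ?(eq_sym 0) oner_eq0.
have b2 (k l : bool) : k%:R = l%:R :> R -> k = l.
  by move/eqP; case: k; case: l; rewrite // ?(eq_sym 0) oner_eq0.
by rewrite /vend (b2 _ _ h1) (b2 _ _ h2).
Qed.

(** The neighbourhood is the complement of the closed set [Q] left when every arc end at the vertex
    of [e0] is shortened by its own length [u e]. *)
Lemma vertex_nbhd e0 (u : A * bool -> R) : (forall e, 0 < u e) ->
  exists O : set X, [/\ open O, O (germ p e0 0) & forall y, O y ->
    exists e (t : R), [/\ vend v e = vend v e0, 0 <= t <= 1, t < u e &
      y = germ p e t]].
Proof.
move=> u0; set w := vend v e0.
pose lo a : R := if vend v (a, false) == w then u (a, false) else 0.
pose hi a : R := if vend v (a, true) == w then 1 - u (a, true) else 1.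
pose Q := [set x | exists a (t : R),
  [/\ 0 <= t <= 1, [set r : R | lo a <= r <= hi a] t & x = p a t]].
have cQ : closed Q.
  by apply: closed_arcs => //; [exact: arc_cont ps|move=> a; exact: seg_closed].
exists (~` Q); split; first exact: closed_openC.
  move=> [a [t [t01 Kt e]]].
  have [i [ti wi]] : exists i : bool, t = i%:R /\ vend v (a, i) = w.
    move: e; rewrite germ0 => /(arc_inj ps) [||[h1 h2]|[i [j [h1 h2 h3]]]] //.
    - by case: e0.2; rewrite ?lexx ler01.
    - by exists e0.2; rewrite -h1 /w /vend /=.
    exists j; split => //; rewrite /vend /= -h3 /w /vend; congr (v _ _).
    by move/eqP: h1; case: e0.2; case: i {h3}; rewrite // ?(eq_sym 0) oner_eq0.
  move: Kt; rewrite /= /lo /hi ti; case: i {ti} wi => ->; rewrite eqxx => /=.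
    by have := u0 (a, true); lra.
  by have := u0 (a, false); lra.
move=> y nQ; have [a [t [t01 yE]]] := arcP pT y.
have [tlo|lot] := ltP t (lo a).
  move: tlo; rewrite /lo; case: eqP => [ew tu|_]; last by lra.
  by exists (a, false), t.
have [hit|thi] := ltP (hi a) t; last first.
  by case: nQ; exists a, t; split=> //=; rewrite lot thi.
move: hit; rewrite /hi; case: eqP => [ew tu|_]; last by lra.
exists (a, true), (1 - t); split=> //; [lra|lra|].
by rewrite yE /germ /= opprB addrC subrK.
Qed.

Lemma subarc_infinite (a : A) (s t : R) (D : set X) : 0 <= s -> s < t -> t <= 1 ->
  finite_set D -> exists r, s < r < t /\ ~ D (p a r).
Proof.
move=> s0 st t1 fD; apply: contrapT => no.
(* The offset 2 in [k.+2] keeps every point strictly below [t]. *)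
pose c (k : nat) : R := s + (t - s) / k.+2%:R.
have ck k : s < c k < t.
  have k2 : 1 < k.+2%:R :> R by rewrite ltr1n.
  have k0 : 0 < k.+2%:R :> R by rewrite ltr0n.
  rewrite /c ltrDl divr_gt0 ?subr_gt0 //= -ltrBrDl ltr_pdivrMr //.
  by rewrite -subr_gt0 -[X in _ - X]mulr1 -mulrBr mulr_gt0 ?subr_gt0.
have fin : finite_set ((fun k => p a (c k)) @^-1` D).
  apply: finite_preimage => // k l _ _ /= e.
  have [||_] := arc_inj_inner ps _ _ e; [have := ck k; lra|have := ck l; lra|].
  move/addrI/mulfI => /(_ _)/invr_inj /eqP; rewrite eqr_nat => h.
  have /h/eqP [] // : t - s != 0 by rewrite subr_eq0; apply/eqP; lra.
apply: infinite_nat; rewrite (_ : setT = (fun k => p a (c k)) @^-1` D) //.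
apply/seteqP; split=> // k _ /=; apply: contrapT => nD; apply: no.
by exists (c k).
Qed.

(** Of two disjoint gaps between points of [B] on one arc, [B] fills at least one ([one]): otherwise
    a missed point in each would enclose a point of [B] and leave another outside. So two of the
    three consecutive gaps are filled, and after removing [D] each of them would have to contain all
    of [B] minus [D] ([two]). *)
Lemma four_points_disconnect (B D : set X) a (t1 t2 t3 t4 : R) :
  connected B -> finite_set D -> D `<=` B -> 0 <= t1 -> t1 < t2 -> t2 < t3 ->
  t3 < t4 -> t4 <= 1 -> D (p a t1) -> D (p a t2) -> D (p a t3) -> D (p a t4) ->
  ~ connected (B `\` D).
Proof.
move=> cB fD DB t10 t12 t23 t34 t41 D1 D2 D3 D4 cC.
pose gap (s t : R) := p a @` [set r : R | s < r < t] `<=` B.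
have one (s t t' s' : R) : 0 <= s -> s < t -> t <= t' -> t' < s' -> s' <= 1 ->
    D (p a s) -> D (p a t) -> gap s t \/ gap t' s'.
  move=> s0 st tt' t's' s'1 Ds Dt; apply: contrapT => /not_orP[].
  move=> /existsNP[_ /not_implyP[[r rst <-] nr]].
  move=> /existsNP[_ /not_implyP[[r' r't's' <-] nr']].
  move: rst r't's' => /= rst r't's'.
  have n0 : B `&` p a @` [set x : R | r < x < r'] !=set0.
    by exists (p a t); split; [exact: DB|exists t => //=; lra].
  have r0 : 0 <= r by lra.
  have r'1 : r' <= 1 by lra.
  have [x /= rx e] := gap_lemma hX ps pT cB r0 r'1 nr nr' n0 (DB _ Ds).
  by have [||_] := arc_inj_inner ps _ _ e; lra.
have two (s t s' t' : R) : 0 <= s -> s < t -> t <= s' -> s' < t' -> t' <= 1 ->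
    D (p a s) -> D (p a t) -> D (p a s') -> D (p a t') ->
    gap s t -> gap s' t' -> False.
  move=> s0 st ts' s't' t'1 Ds Dt Ds' Dt' g g'.
  have sub (x y : R) : 0 <= x -> x < y -> y <= 1 -> D (p a x) -> D (p a y) ->
      gap x y -> B `\` D `<=` p a @` [set r : R | x < r < y].
    move=> x0 xy y1 Dx Dy gxy; apply: (gap_lemma hX ps pT cC) => //.
    - by case.
    - by case.
    have [r [rxy nD]] := subarc_infinite a x0 xy y1 fD.
    by exists (p a r); split; [split=> //; apply: gxy|]; exists r.
  have [|r [r' nD]] := subarc_infinite a s0 st _ fD; first by lra.
  have Br : (B `\` D) (p a r) by split=> //; apply: g; exists r.
  have s'0 : 0 <= s' by lra.
  have [x /= rx e] := sub s' t' s'0 s't' t'1 Ds' Dt' g' _ Br.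
  by have [||_] := arc_inj_inner ps _ _ e; lra.
have t20 : 0 <= t2 by lra.
have t30 : 0 <= t3 by lra.
have t21 : t2 <= 1 by lra.
have t31 : t3 <= 1 by lra.
have [g12|g23] := one t1 t2 t2 t3 t10 t12 (lexx _) t23 t31 D1 D2.
  have [g23|g34] := one t2 t3 t3 t4 t20 t23 (lexx _) t34 t41 D2 D3.
    exact: (two t1 t2 t2 t3).
  by apply: (two t1 t2 t3 t4) => //; lra.
have [g12|g34] := one t1 t2 t3 t4 t10 t12 (ltW t23) t34 t41 D1 D2.
  exact: (two t1 t2 t2 t3).
exact: (two t2 t3 t3 t4).
Qed.

(** Pigeonhole: once each point is assigned to one arc through it, more than three per arc on
    average puts four on a single arc. *)
Lemma disconnects_bound (B : set X) : connected B ->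
  forall D : set X, D `<=` B -> D #= `I_(3 * #|A|).+1 -> ~ connected (B `\` D).
Proof.
move=> cB D DB cD; have fD : finite_set D by apply/finite_setP; eexists; exact: cD.
have [f fi Df] := card_II_inj cD.
set N := (3 * #|A|).+1 in f fi Df.
have /choice [at_ atE] (i : 'I_N) :
    exists at_ : A * R, 0 <= at_.2 <= 1 /\ f i = p at_.1 at_.2.
  by have [a [t [t01 e]]] := arcP pT (f i); exists (a, t).
have f_inj (i j : 'I_N) : at_ i = at_ j -> i = j.
  move=> e; apply: fi; have [_ ->] := atE i; have [_ ->] := atE j; by rewrite e.
have [a a4] : exists a, (3 < #|[set i : 'I_N | (at_ i).1 == a]%SET|)%N.
  apply: contrapT => /forallNP no.
  have : (#|'I_N| <= \sum_(a : A) 3)%N.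
    rewrite -sum1_card (partition_big (fun i => (at_ i).1) predT) //=.
    apply: leq_sum => a _; rewrite sum1_card leqNgt; apply/negP => h; apply: (no a).
    apply: leq_trans h _; apply: subset_leq_card.
    by apply/fintype.subsetP => i; rewrite !inE.
  by rewrite card_ord sum_nat_const /N mulnC ltnn.
set S := [set i : 'I_N | (at_ i).1 == a]%SET in a4.
pose s := sort <=%R [seq (at_ i).2 | i <- enum S].
have us : uniq s.
  rewrite sort_uniq map_inj_in_uniq ?enum_uniq // => i j.
  rewrite !mem_enum !inE => /eqP ia /eqP ja e; apply: f_inj.
  by rewrite [LHS]surjective_pairing [RHS]surjective_pairing ia ja e.
have ss : sorted <%R s by rewrite lt_sorted_uniq_le us sort_le_sorted.
have zs : (3 < size s)%N by rewrite size_sort size_map -cardE.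
have sD t : t \in s -> 0 <= t <= 1 /\ D (p a t).
  rewrite mem_sort => /mapP[i]; rewrite mem_enum inE => /eqP ia ->.
  by have [t01 e] := atE i; split=> //; rewrite -ia -e.
case: s us ss zs sD => [|t1 [|t2 [|t3 [|t4 s]]]] //= _ /and4P[t12 t23 t34 _] _ sD.
have [h1 D1] := sD t1 (ltac:(rewrite !inE eqxx ?orbT; exact: isT)).
have [h2 D2] := sD t2 (ltac:(rewrite !inE eqxx ?orbT; exact: isT)).
have [h3 D3] := sD t3 (ltac:(rewrite !inE eqxx ?orbT; exact: isT)).
have [h4 D4] := sD t4 (ltac:(rewrite !inE eqxx ?orbT; exact: isT)).
by apply: (@four_points_disconnect B D a t1 t2 t3 t4) => //; lra.
Qed.

End VertexNeighbourhoods.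

(** * Simple arc systems are graphs *)

Lemma rV_hausdorff (R : realType) n : hausdorff_space 'rV[R]_n.
Proof.
move=> x y xy; apply/rowP => i; apply: Rhausdorff => P Q nP nQ.
have cP := @coord_continuous R 1 n ord0 i x _ nP.
have cQ := @coord_continuous R 1 n ord0 i y _ nQ.
by have [z [zP zQ]] := xy _ _ cP cQ; exists (z ord0 i).
Qed.

Lemma rV_continuous (R : realType) (X : topologicalType) n (f : X -> 'rV[R]_n) :
  (forall i, continuous (fun x => f x ord0 i)) -> continuous f.
Proof.
move=> cf x P [Q nQ QP]; apply: filterS (fun y => QP (f y)) _ => /=.
apply: filter_forall => i; apply: filter_forall => j; rewrite (ord1 i).
by apply: (cf j x); have := nQ i j; rewrite (ord1 i).
Qed.

Lemma continuous_within_comp (X Y Z : topologicalType) (B : set Y) (f : X -> Y)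
    (g : Y -> Z) : continuous f -> (forall x, B (f x)) ->
  {within B, continuous g} -> continuous (g \o f).
Proof.
move=> cf fB /continuousP cg; apply/continuousP => O oO.
have /open_subspaceP [V oV VB] := cg _ oO.
rewrite (_ : _ @^-1` O = f @^-1` V).
  exact: ((continuousP _).1 cf).
apply/seteqP; split=> x /= h.
  have : (g @^-1` O `&` B) (f x) by split.
  by rewrite -VB => -[].
have : (V `&` B) (f x) by split.
by rewrite VB => -[].
Qed.

Section Segments.
Context (R : realType) (n : nat).
Implicit Types i j : 'I_n.

Definition segment i j (t : R) : 'rV[R]_n :=
  (1 - t) *: delta_mx ord0 i + t *: delta_mx ord0 j.

Lemma segmentE i j t k :
  segment i j t ord0 k = (1 - t) * (k == i)%:R + t * (k == j)%:R.
Proof. by rewrite !mxE eqxx /=. Qed.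

Lemma segment_continuous i j : continuous (segment i j).
Proof.
apply: rV_continuous => k; rewrite (_ : (fun _ => _) =
  (fun t : R => (1 - t) * (k == i)%:R + t * (k == j)%:R)); last first.
  by apply/funext => t; rewrite segmentE.
move=> t; apply: cvgD; apply: cvgM; try exact: cvg_cst; try exact: cvg_id.
by apply: cvgB; [exact: cvg_cst|exact: cvg_id].
Qed.

Lemma segment0 i j : segment i j 0 = delta_mx ord0 i.
Proof. by rewrite /segment subr0 scale1r scale0r addr0. Qed.

Lemma segment1 i j : segment i j 1 = delta_mx ord0 j.
Proof. by rewrite /segment subrr scale0r scale1r add0r. Qed.

Lemma segment_carrier (K : {set {set 'I_n}}) i j t : simplicial_complex K ->
  [set i; j]%SET \in K -> 0 <= t <= 1 -> carrier K (segment i j t).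
Proof.
move=> [_ down] ijK t01; split.
- by move=> k; rewrite segmentE; case: (k == i); case: (k == j) => /=; lra.
- have s1 (k : 'I_n) : \sum_(l < n) (l == k)%:R = 1 :> R.
    by rewrite (bigD1 k) //= eqxx big1 ?addr0 // => l /negbTE ->.
  under eq_bigr do rewrite segmentE.
  by rewrite big_split /= -!mulr_sumr !s1 !mulr1 subrK.
apply: (down _ _ ijK).
  apply/fintype.subsetP => k; rewrite !inE segmentE.
  by case: (k == i); case: (k == j); rewrite //= !mulr0 addr0 eqxx.
apply/finset.set0Pn; have [t0|t0] := eqVneq t 0.
  exists i; rewrite !inE segmentE eqxx t0 subr0 mul0r addr0 mulr1.
  exact: oner_neq0.
exists j; rewrite !inE segmentE eqxx mulr1.
by apply/eqP; case: (j == i) => /=; move/eqP: t0; lra.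
Qed.

Lemma carrier_pair (x : 'rV[R]_n) i j : i != j -> (forall k, 0 <= x ord0 k) ->
  \sum_(k < n) x ord0 k = 1 ->
  ([set k | x ord0 k != 0] \subset [set i; j])%SET ->
  0 <= x ord0 j <= 1 /\ x = segment i j (x ord0 j).
Proof.
move=> ij x0 x1 /fintype.subsetP xij.
have xk k : k != i -> k != j -> x ord0 k = 0.
  move=> ki kj; apply/eqP; apply: contraNT ki => xk0.
  by have := xij k; rewrite !inE (negbTE kj) orbF => -> //.
have xs : x ord0 i + x ord0 j = 1.
  rewrite -[RHS]x1 (bigD1 i) //= (bigD1 j) 1?eq_sym //= big1 ?addr0 //.
  by move=> k /andP[ki kj]; exact: xk.
split; first by have := x0 i; have := x0 j; lra.
apply/rowP => k; rewrite (ord1 ord0) segmentE.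
have [->|ki] := eqVneq k i; first by rewrite (negbTE ij) mulr0 addr0 mulr1; lra.
have [->|kj] := eqVneq k j; first by rewrite mulr0 add0r mulr1.
by rewrite !mulr0 addr0 xk.
Qed.

End Segments.

Section SimpleArcSystem.
Context (R : realType) (X : metricType R).
Context (A W : finType) (v : A -> bool -> W) (p : A -> R -> X).
Context (ps : arc_system v p).
Context (bip : forall a b, v a false != v b true).
Context (simp : forall a b, v a false = v b false -> v a true = v b true -> a = b).
Context (a0 : A).

Let rk (w : W) : 'I_#|W| := enum_rank w.
Let rkE w w' : (rk w == rk w') = (w == w').
Proof. by rewrite /rk (inj_eq enum_rank_inj). Qed.

Definition arc_edge a : {set 'I_#|W|} := [set rk (v a false); rk (v a true)]%SET.

(** Only faces of edges are taken, so an element of [W] at which no arc ends is not a vertex of the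
    complex. *)
Definition arc_complex : {set {set 'I_#|W|}} :=
  [set s : {set 'I_#|W|} |
     [exists a, (s != finset.set0) && (s \subset arc_edge a)]]%SET.

Definition arc_segment a : R -> 'rV[R]_#|W| :=
  segment (rk (v a false)) (rk (v a true)).

Lemma arc_edge_in a : arc_edge a \in arc_complex.
Proof.
rewrite inE; apply/existsP; exists a; rewrite subxx andbT.
by apply/finset.set0Pn; exists (rk (v a false)); rewrite !inE eqxx.
Qed.

Lemma card_arc_edge a : #|arc_edge a| = 2%N.
Proof. by rewrite cards2 rkE bip. Qed.

Lemma arc_complexP : simplicial_complex arc_complex /\ one_dimensional arc_complex.
Proof.
split; split.
- by move=> s; rewrite inE => /existsP[a /andP[]].
- move=> s t; rewrite !inE => /existsP[a /andP[_ sa]] ts t0.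
  by apply/existsP; exists a; rewrite t0 (fintype.subset_trans ts sa).
- move=> s; rewrite !inE => /existsP[a /andP[_ /subset_leq_card]].
  by rewrite card_arc_edge.
- by exists (arc_edge a0); [exact: arc_edge_in|exact: card_arc_edge].
Qed.

Lemma arc_segment_system : arc_system v arc_segment.
Proof.
split.
- by move=> a; exact: segment_continuous.
- move=> a b i j vij.
  have nb c d : v c true <> v d false.
    by move/esym/eqP; rewrite (negbTE (bip d c)).
  rewrite /arc_segment; case: i vij; case: j => vij.
  + by rewrite !segment1 vij.
  + by case: (nb _ _ vij).
  + by case: (nb _ _ (esym vij)).
  + by rewrite !segment0 vij.
move=> a b t s t01 s01 e.
have ek w : (1 - t) * (w == v a false)%:R + t * (w == v a true)%:R =
            (1 - s) * (w == v b false)%:R + s * (w == v b true)%:R.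
  by have := congr1 (fun y : 'rV_ _ => y ord0 (rk w)) e; rewrite !segmentE !rkE.
have nb c d : (v c true == v d false) = false by rewrite eq_sym; exact/negbTE.
(* Comparing the barycentric coordinates at the four end vertices leaves linear arithmetic in [t]
   and [s], with one case for each way of sharing ends. *)
have := ek (v a false); have := ek (v a true); have := ek (v b false).
have := ek (v b true); rewrite !eqxx !(negbTE (bip _ _)) !nb /=.
rewrite ![v b _ == _]eq_sym.
case: (v a false =P v b false) => ef; case: (v a true =P v b true) => et /=.
- by move=> *; left; split; [exact: simp|lra].
- move=> *; right; exists false, false; split => //; rewrite /=; lra.
- move=> *; right; exists true, true; split => //; rewrite /=; lra.
by move=> *; exfalso; lra.
Qed.

Lemma arc_carrier : carrier arc_complex = arc_union arc_segment.
Proof.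
have [sc _] := arc_complexP.
apply/seteqP; split=> x; last first.
  by move=> [a [t [t01 ->]]]; apply: segment_carrier => //; exact: arc_edge_in.
move=> [x0 x1]; rewrite inE => /existsP[a /andP[_ xa]]; exists a.
have [|h e] := carrier_pair _ x0 x1 xa; first by rewrite rkE bip.
by exists (x ord0 (rk (v a true))).
Qed.

(** Gluing along arcs is applied in both directions, which gives the homeomorphism and its
    continuous inverse alike. *)
Lemma arc_triangulation : exists h : 'rV[R]_#|W| -> X,
  triangulation (arc_union p) arc_complex h /\
  forall a t, 0 <= t <= 1 -> h (arc_segment a t) = p a t.
Proof.
have hX := @metric_hausdorff _ X.
have [h [ch hE]] := glue_arcs (@rV_hausdorff R _) arc_segment_system
  (arc_cont ps) (arc_vertex ps) (ex_intro _ (p a0 0) I).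
have [k [ck kE]] := glue_arcs hX ps (arc_cont arc_segment_system)
  (arc_vertex arc_segment_system) (ex_intro _ (0 : 'rV[R]_#|W|) I).
have hk : {in carrier arc_complex, cancel h k}.
  by move=> x; rewrite inE arc_carrier => -[a [t [t01 ->]]]; rewrite hE // kE.
exists h; split => //; have [sc od] := arc_complexP; split=> //.
split; last by split; [rewrite arc_carrier|exists k].
split.
- move=> x; rewrite arc_carrier => -[a [t [t01 ->]]].
  by rewrite hE //; exists a, t.
- by move=> x y xc yc e; rewrite -(hk _ xc) -(hk _ yc) e.
move=> x [a [t [t01 ->]]]; exists (arc_segment a t); last exact: hE.
by rewrite arc_carrier; exists a, t.
Qed.

Lemma arc_union_graph : connected (arc_union p) -> is_graph (arc_union p).
Proof.
move=> cp; split=> //; first exact/arc_union_compact/(arc_cont ps).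
by have [h [tr _]] := arc_triangulation; exists #|W|, arc_complex, h.
Qed.

Lemma arc_endpoint e : (forall e', vend v e' = vend v e -> e' = e) ->
  endpoint (arc_union p) (germ p e 0).
Proof.
move=> uniq_e; have [h [tr hE]] := arc_triangulation.
have rk_edge b (i : bool) : rk (v b i) \in arc_edge b.
  by rewrite !inE; case: i; rewrite eqxx ?orbT.
exists #|W|, arc_complex, h, (rk (vend v e)); split=> //.
- rewrite inE; apply/existsP; exists e.1; apply/andP; split.
    by apply/finset.set0Pn; exists (rk (vend v e)); rewrite inE.
  by rewrite finset.sub1set rk_edge.
- rewrite germ0 -hE; last by case: e.2; rewrite lexx ler01.
  by rewrite /vend; case: e.2; rewrite /arc_segment ?segment1 ?segment0.
rewrite (_ : [set s in _ | _]%SET = [set arc_edge e.1]%SET) ?cards1 //.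
apply/setP => s; rewrite !inE; apply/idP/eqP => [|->]; last first.
  have := arc_edge_in e.1; rewrite inE => ->.
  by rewrite card_arc_edge rk_edge.
move=> /and3P[/existsP[b /andP[_ sb]] es /eqP s2].
have sE : s = arc_edge b.
  by apply/eqP; rewrite eqEcard sb s2 card_arc_edge.
suff -> : e.1 = b by [].
move: es; rewrite sE !inE !rkE => /orP[] /eqP eb.
  by rewrite -(uniq_e (b, false)).
by rewrite -(uniq_e (b, true)).
Qed.

End SimpleArcSystem.

(** * Arcs of a triangulated graph *)

Section GraphArcs.
Context (R : realType).

(** The retraction of the line onto [0, 1]; it extends arcs to all real parameters, so that they are
    continuous outright. *)
Definition clamp (t : R) : R := Num.max 0 (Num.min t 1).

Lemma clamp01 t : 0 <= clamp t <= 1.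
Proof. by rewrite /clamp le_max ge_max lexx ler01 ge_min lexx orbT. Qed.

Lemma clamp_id t : 0 <= t <= 1 -> clamp t = t.
Proof.
move=> /andP[t0 t1]; rewrite /clamp; have -> : Num.min t 1 = t by apply/min_idPl.
exact/max_idPr.
Qed.

Lemma clamp_continuous : continuous clamp.
Proof.
move=> t; apply: (@continuous_max R R (fun=> 0) (fun t => Num.min t 1)).
  exact: cvg_cst.
by apply: (@continuous_min R R id (fun=> 1)); [exact: cvg_id|exact: cvg_cst].
Qed.

Lemma segment_inj n (i j k l : 'I_n) (t s : R) : (i < j)%N -> (k < l)%N ->
  0 <= t <= 1 -> 0 <= s <= 1 -> segment i j t = segment k l s ->
  ((i, j) = (k, l) /\ t = s) \/ exists b c : bool,
    [/\ t = b%:R, s = c%:R & (if b then j else i) = if c then l else k].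
Proof.
move=> ij kl t01 s01 e.
have ek m : (1 - t) * (m == i)%:R + t * (m == j)%:R =
            (1 - s) * (m == k)%:R + s * (m == l)%:R.
  by have := congr1 (fun y : 'rV_ _ => y ord0 m) e; rewrite !segmentE.
have := ek j; have := ek i; rewrite !eqxx (eq_sym j i).
have -> : (i == j) = false by apply/negbTE/eqP => h; rewrite h ltnn in ij.
have nkl : (k == l) = false by apply/negbTE/eqP => h; rewrite h ltnn in kl.
case: (i =P k) => ik; case: (i =P l) => il /=.
- by move: nkl; rewrite -ik -il eqxx.
- case: (j =P k) => jk /=; first by rewrite jk ik ltnn in ij.
  case: (j =P l) => jl /=.
    by move=> *; left; rewrite ik jl; split=> //; lra.
  by move=> *; right; exists false, false; rewrite ik /=; split => //; lra.
- case: (j =P k) => jk /=.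
    by move: ij kl; rewrite jk il => /ltnW; rewrite leqNgt => /negP.
  case: (j =P l) => jl /=; first by rewrite jl il ltnn in ij.
  by move=> *; right; exists false, true; rewrite il /=; split => //; lra.
case: (j =P k) => jk /=; case: (j =P l) => jl /=.
- by move: nkl; rewrite -jk -jl eqxx.
- by move=> *; right; exists true, false; rewrite jk /=; split => //; lra.
- by move=> *; right; exists true, true; rewrite jl /=; split => //; lra.
by move=> *; exfalso; lra.
Qed.

(** Ensures that the edges alone cover the graph. At an isolated vertex, positivity of its
    barycentric coordinate would define a clopen singleton, which would be the whole space although
    the complex has an edge. *)
Lemma vertex_on_edge (X : metricType R) n (K : {set {set 'I_n}}) h i :
  connected [set: X] -> triangulation [set: X] K h -> [set i]%SET \in K ->
  exists2 j, j != i & [set i; j]%SET \in K.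
Proof.
move=> cX [sc [K2 [s0 s0K s02]] [hb [ch [k [ck hk]]]]] iK.
apply: contrapT => no.
have noedge (s : {set 'I_n}) : s \in K -> i \in s -> s = [set i]%SET.
  move=> sK si; apply/eqP; rewrite eq_sym finset.eqEsubset finset.sub1set si /=.
  apply/fintype.subsetP => j js; rewrite inE; apply/negPn/negP => ji.
  apply: no; exists j => //; apply: (sc.2 s) => //.
    by apply/fintype.subsetP => l; rewrite !inE => /orP[]/eqP->.
  by apply/finset.set0Pn; exists i; rewrite !inE eqxx.
have delta_car j l : j != l -> forall t, [set j; l]%SET \in K ->
    0 <= t <= 1 -> carrier K (segment j l t : 'rV[R]_n).
  by move=> _ t jl t01; exact: segment_carrier.
have [_ hinj hsurj] := hb.
have kh z : h (k z) = z /\ carrier K (k z).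
  have [y yc <-] := hsurj z I.
  by rewrite hk ?inE.
have kc : continuous k by apply/continuous_subspace_setT.
pose O := [set z | 0 < k z ord0 i].
have kic : continuous (fun z => k z ord0 i).
  move=> z; apply: (@continuous_comp _ _ _ k (fun y : 'rV[R]_n => y ord0 i)).
    exact: kc.
  exact: coord_continuous.
have oO : open O by exact: ((continuousP _).1 kic _ (@open_gt R 0)).
have Oeq z : O z -> k z = delta_mx ord0 i.
  move=> zO; have [_ [k0 k1 kK]] := kh z.
  have si := noedge _ kK; rewrite !inE (gt_eqF zO) in si; have {}si := si isT.
  apply/rowP => j; rewrite mxE eqxx /=.
  have kj l : l != i -> k z ord0 l = 0.
    move=> li; apply/eqP; apply: contraNT li => kl.
    have : l \in [set m | k z ord0 m != 0]%SET by rewrite inE.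
    by rewrite si inE.
  have [->|ji] := eqVneq j i; last exact: kj.
  by rewrite -k1 (bigD1 i) //= big1 ?addr0.
have [i0 zO] : exists z, O z.
  have ic : carrier K (delta_mx ord0 i : 'rV[R]_n).
    split.
    - by move=> j; rewrite mxE; case: (_ && _).
    - rewrite (bigD1 i) //= mxE !eqxx big1 ?addr0 // => j /negbTE ji.
      by rewrite mxE ji andbF.
    rewrite (_ : [set _ | _]%SET = [set i]%SET) //.
    apply/setP => j; rewrite !inE mxE eqxx /=.
    by case: (j == i); rewrite ?eqxx ?oner_neq0.
  by exists (h (delta_mx ord0 i)); rewrite /O /= hk ?inE // mxE !eqxx ltr01.
have OT : [set: X] `<=` O.
  apply: (@connected_clopen _ _ _ [set i0]) => //.
  - exact: (compact_closed (@metric_hausdorff _ X) (@compact_set1 _ _)).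
  - apply/seteqP; split=> z [_]; last by move=> ->.
    move=> Oz; split=> //=; have [<- _] := kh z; have [<- _] := kh i0.
    by rewrite !Oeq.
  by exists i0.
move/eqP/cards2P: s02 => [a [b [ab s0E]]].
have ha : O (h (segment a b 0)) by exact: OT.
have hb' : O (h (segment a b 1)) by exact: OT.
move: (Oeq _ ha) (Oeq _ hb'); rewrite !hk ?inE.
- rewrite segment0 segment1 => <- /(congr1 (fun y : 'rV[R]_n => y ord0 a)).
  by rewrite !mxE !eqxx (negbTE ab) /= => /esym/eqP; rewrite oner_eq0.
- by apply: delta_car; rewrite -?s0E // ler01 lexx.
by apply: delta_car; rewrite -?s0E // ler01 lexx.
Qed.

Lemma graph_arc_system (X : metricType R) : is_graph [set: X] ->
  exists (A W : finType) (v : A -> bool -> W) (p : A -> R -> X),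
  [/\ arc_system v p, arc_union p = [set: X],
      forall a, v a false <> v a true & exists a : A, True].
Proof.
move=> [_ cX [n [K [h tr]]]]; have [sc [K2 [s0 s0K s02]] [hb [ch _]]] := tr.
have [_ hinj hsurj] := hb.
(* Ordering the two vertices selects one orientation of each edge and rules out loops. *)
pose edge (e : 'I_n * 'I_n) := (e.1 < e.2)%N && ([set e.1; e.2]%SET \in K).
pose A := {e : 'I_n * 'I_n | edge e}.
pose v (a : A) (b : bool) := if b then (val a).2 else (val a).1.
pose p (a : A) (t : R) := h (segment (val a).1 (val a).2 (clamp t)).
have pE a (t : R) : 0 <= t <= 1 -> p a t = h (segment (v a false) (v a true) t).
  by move=> t01; rewrite /p clamp_id.
have car (a : A) (t : R) : 0 <= t <= 1 -> carrier K (segment (v a false) (v a true) t).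
  move=> t01; apply: segment_carrier => //.
  by case: a => a /= /andP[].
have mkA (i j : 'I_n) : i != j -> [set i; j]%SET \in K ->
    exists a : A, [set v a false; v a true]%SET = [set i; j]%SET.
  rewrite neq_ltn => /orP[ij|ji] ijK.
    have h1 : edge (i, j) by rewrite /edge ij.
    by exists (exist _ (i, j) h1).
  have h1 : edge (j, i) by rewrite /edge ji /= finset.setUC.
  by exists (exist _ (j, i) h1); rewrite /v /= finset.setUC.
have vlt a : (v a false < v a true)%N by case: a => a /= /andP[].
exists A, 'I_n, v, p; split.
- split.
  + move=> a; apply: (@continuous_within_comp _ _ _ (carrier K)
      (fun t => segment (val a).1 (val a).2 (clamp t)) h) => //.
      move=> t; apply: continuous_comp; first exact: clamp_continuous.
      exact: segment_continuous.
    by move=> t; exact: (car a _ (clamp01 t)).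
  + move=> a b i j vij; rewrite !pE; last 2 first.
      by case: j {vij}; rewrite lexx ler01.
      by case: i {vij}; rewrite lexx ler01.
    congr h; have vE c (k : bool) : segment (v c false) (v c true) k%:R =
        delta_mx ord0 (v c k) :> 'rV[R]_n.
      by case: k; rewrite ?segment1 ?segment0.
    by rewrite !vE vij.
  move=> a b t s t01 s01; rewrite !pE // => /hinj; rewrite !inE.
  move=> /(_ (car _ _ t01) (car _ _ s01)).
  move/(segment_inj (vlt a) (vlt b) t01 s01) => [[ab ->]|[i [j [-> -> e]]]].
    by left; split=> //; apply/val_inj; move: ab; rewrite /v -!surjective_pairing.
  by right; exists i, j; split=> //; case: i j e => [] [].
- apply/seteqP; split=> // x _; have [y [y0 y1 yK] <-] := hsurj x I.
  set s := [set i | _]%SET in yK.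
  have [i [j [ij ijK sij]]] : exists i j, [/\ i != j, [set i; j]%SET \in K &
      s \subset [set i; j]%SET].
    have := K2 _ yK; rewrite leq_eqVlt ltnS => /orP[/cards2P[i [j [ij sE]]]|s1].
      by exists i, j; rewrite -sE.
    have /eqP/cards1P[i sE] : #|s| = 1%N.
      by apply/eqP; rewrite eqn_leq s1 card_gt0 (sc.1 _ yK).
    have [|j ji ijK] := @vertex_on_edge X n K h i cX tr; first by rewrite -sE.
    exists i, j; split=> //; first by rewrite eq_sym.
    by rewrite sE finset.sub1set !inE eqxx.
  have [a aE] := mkA _ _ ij ijK; rewrite -aE in sij.
  have [|t01 yE] := carrier_pair _ y0 y1 sij.
    by apply/eqP => e; have := vlt a; rewrite e ltnn.
  by exists a, (y ord0 (v a true)); rewrite pE // -yE.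
- by move=> a e; have := vlt a; rewrite e ltnn.
have /cards2P[i [j [ij sE]]] : #|s0| == 2%N by rewrite s02.
by have [|a _] := mkA _ _ ij; [rewrite -sE|exists a].
Qed.

End GraphArcs.

(** * Subsets of a metric space as metric spaces *)

Section Submetric.
Context (R : realType) (T : metricType R) (B : set T).

Definition submetric : Type := {x : T | x \in B}.

HB.instance Definition _ := Choice.on submetric.

Definition subdist (x y : submetric) : R := mdist (val x) (val y).

Lemma subdistxx x : subdist x x = 0.
Proof. exact: mdistxx. Qed.

Lemma subdist_positivity x y : subdist x y = 0 -> x = y.
Proof. by move/mdist_positivity/val_inj. Qed.

Lemma subdist_sym x y : subdist x y = subdist y x.
Proof. exact: metric_sym. Qed.

Lemma subdist_triangle y x z : subdist x z <= subdist x y + subdist y z.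
Proof. exact: metric_triangle. Qed.

HB.instance Definition _ := @isMetric.Build R submetric subdist subdistxx
  subdist_positivity subdist_sym subdist_triangle.

Lemma ball_submetric (x : submetric) e y : ball x e y = ball (val x) e (val y).
Proof. by rewrite !ballEmdist. Qed.

Lemma submetric_val_continuous : continuous (val : submetric -> T).
Proof.
move=> x; apply/(@cvg_ballP R T submetric (nbhs x) (nbhs_filter x) val (val x)) => e e0.
have h := nbhsx_ballx x e e0; near=> y.
by rewrite -ball_submetric; near: y.
Unshelve. all: by end_near. Qed.

Lemma submetric_lift_continuous (X : topologicalType) (f : X -> submetric) :
  continuous (fun x => val (f x)) -> continuous f.
Proof.
move=> cf x; apply/cvg_ballP => e e0.
have := cf x; move/cvg_ballP => /(_ e e0); apply: filterS => y.
by rewrite ball_submetric.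
Qed.

End Submetric.

(** * Absorbing arcs and spreading families *)

Definition ev (P : nat -> Prop) := exists N, forall n, (N <= n)%N -> P n.

Lemma ev_sub (P Q : nat -> Prop) : (forall n, P n -> Q n) -> ev P -> ev Q.
Proof. by move=> PQ [N NP]; exists N => n /NP /PQ. Qed.

Lemma evI (P Q : nat -> Prop) : ev P -> ev Q -> ev (fun n => P n /\ Q n).
Proof.
move=> [N NP] [M MQ]; exists (maxn N M) => n; rewrite geq_max => /andP[/NP ? /MQ ?].
by split.
Qed.

Lemma ev_forall (I : finType) (P : I -> nat -> Prop) :
  (forall i, ev (P i)) -> ev (fun n => forall i, P i n).
Proof.
move=> /choice [N NP]; exists (\max_i N i) => n hn i; apply: NP.
exact: leq_trans (leq_bigmax i) hn.
Qed.

Lemma ev_ex (P : nat -> Prop) : ev P -> exists n, P n.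
Proof. by move=> [N NP]; exists N; exact: NP. Qed.

(** Numerical semigroup argument: with [n = q * a + r], also [n = (q - r) * a + r * a.+1], and
    [r <= q] as soon as [a * a <= n]. *)
Lemma sum_closed_cofinite (S : nat -> Prop) a : S 0%N ->
  (forall m n, S m -> S n -> S (m + n)%N) -> S a -> S a.+1 -> ev S.
Proof.
move=> S0 SD Sa Sa1; have SM k m : S m -> S (k * m)%N.
  by move=> Sm; elim: k => [|k IH]; rewrite ?mul0n // mulSn; exact: SD.
exists (a * a)%N => n hn; have [a0|a_gt0] := posnP a.
  by rewrite -(muln1 n); apply: SM; rewrite a0 in Sa1.
have r_q : (n %% a <= n %/ a)%N.
  by rewrite (leq_trans (ltnW (ltn_pmod n a_gt0))) // leq_divRL.
have -> : n = ((n %/ a - n %% a) * a + n %% a * a.+1)%N.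
  rewrite mulnS [(_ + _ * a)%N]addnC addnA -mulnDl subnK //.
  exact: divn_eq.
by apply: SD; exact: SM.
Qed.

(** Read [T i j n] as: the arc [j] lies in the [n]-th image of the arc [i]. Each arc misses at most
    one target at every large time. The index is chosen before [P], so that one arc serves all
    connected sets. *)
Lemma absorbing_index (T : 'I_3 -> 'I_3 -> nat -> Prop) N :
  (forall i, T i i 0%N) ->
  (forall i j k m n, T i j m -> T j k n -> T i k (n + m)%N) ->
  (forall n i k l, (N <= n)%N -> k != l -> T i k n \/ T i l n) ->
  exists k0, forall P : nat -> 'I_3 -> Prop,
    (forall n j m k, P n j -> T j k m -> P (m + n)%N k) ->
    ev (fun n => forall k l, k != l -> P n k \/ P n l) ->
    ev (fun n => P n k0).
Proof.
move=> T0 Tt TN.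
pose o0 : 'I_3 := @Ordinal 3 0 isT.
pose o1 : 'I_3 := @Ordinal 3 1 isT.
pose o2 : 'I_3 := @Ordinal 3 2 isT.
have [[i Ti]|noi] := pselect (exists i, forall j, exists n, T j i n).
  exists i => P Pt [M MP].
  (* At most one of three targets is missed at time [N] and at most one at time [N.+1]. The common
     target returns to [i], which gives [i] two consecutive return times. *)
  have [j [TjN TjN1]] : exists j, T i j N /\ T i j N.+1.
    have h1 := TN N i; have h2 := TN N.+1 i.
    have a01 := h1 o0 o1 (leqnn _) isT; have a02 := h1 o0 o2 (leqnn _) isT.
    have a12 := h1 o1 o2 (leqnn _) isT.
    have b01 := h2 o0 o1 (leqnSn _) isT; have b02 := h2 o0 o2 (leqnSn _) isT.
    have b12 := h2 o1 o2 (leqnSn _) isT.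
    have [x0|x0] := pselect (T i o0 N /\ T i o0 N.+1); first by exists o0.
    have [x1|x1] := pselect (T i o1 N /\ T i o1 N.+1); first by exists o1.
    by exists o2; tauto.
  have [s Tjs] := Ti j.
  have [K KT] : ev (T i i).
    apply: (@sum_closed_cofinite _ (s + N)%N) => //.
    - by move=> m n Tm Tn; rewrite addnC; exact: Tt Tm Tn.
    - exact: Tt TjN Tjs.
    by rewrite -addnS; exact: Tt TjN1 Tjs.
  have [k Pk] : exists k, P M k.
    by case: (MP M (leqnn _) o0 o1 isT) => h; eexists; exact: h.
  have [m Tm] := Ti k; have Pi := Pt _ _ _ _ Pk Tm.
  exists (K + (m + M))%N => n hn.
  have -> : n = ((n - (m + M)) + (m + M))%N by rewrite subnK //; lia.
  by apply: Pt Pi _; apply: KT; lia.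
(* No arc is reached from all three. Then [j0], which never reaches [o0], always covers the other
   two at large times; likewise [j1] with [o1]. Hence both always cover [o2], and a set covering all
   but one arc covers [j0] or [j1]. *)
have nT i : exists j, forall n, ~ T j i n.
  apply: contrapT => h; apply: noi; exists i => j; apply: contrapT => h'.
  by apply: h; exists j => n Tn; apply: h'; exists n.
have [j0 h0] := nT o0; have [j1 h1] := nT o1.
have t0 n k : (N <= n)%N -> k != o0 -> T j0 k n.
  by move=> hn hk; case: (TN n j0 k o0 hn hk) => // /h0.
have t1 n k : (N <= n)%N -> k != o1 -> T j1 k n.
  by move=> hn hk; case: (TN n j1 k o1 hn hk) => // /h1.
have j01 : j0 != j1.
  by apply/eqP => e; apply: (h1 N); rewrite -e; exact: t0.
exists o2 => P Pt [M MP]; exists (M + N)%N => n hn.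
have -> : n = (N + (n - N))%N by rewrite subnKC //; lia.
have [|h|h] := MP (n - N)%N _ j0 j1 j01; first by lia.
  by apply: Pt h _; exact: t0.
by apply: Pt h _; exact: t1.
Qed.

Definition nondegenerate (X : Type) (J : set X) :=
  exists x y, [/\ J x, J y & x <> y].

Section Core.
Context (R : realType) (X : metricType R).
Context (A W : finType) (v : A -> bool -> W) (p : A -> R -> X).
Context (ps : arc_system v p) (pT : arc_union p = [set: X]).

Let hX : hausdorff_space X := @metric_hausdorff _ X.

Definition subarc a (s t : R) : set X := p a @` [set r : R | s <= r <= t].

Lemma subarc_connected a s t : connected (subarc a s t).
Proof.
apply: connected_image; first exact: arc_cont ps a.
by apply: convex_connected => x y z /=; lra.
Qed.

Lemma subarc_nondegenerate a s t : 0 <= s -> s < t -> t < 1 ->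
  nondegenerate (subarc a s t).
Proof.
move=> s0 st t1; exists (p a t), (p a s); split.
- by exists t => //=; lra.
- by exists s => //=; lra.
by move=> /(arc_inj_inner ps) [||_ ?]; lra.
Qed.

Lemma gap_contra (C : set X) a (s t u w : R) : connected C -> 0 <= s -> t <= 1 ->
  ~ C (p a s) -> ~ C (p a t) -> C (p a u) -> s < u < t -> C (p a w) ->
  0 <= w <= 1 -> (w <= s \/ t <= w) -> False.
Proof.
move=> cC s0 t1 ns nt Cu su Cw w01 w_out.
have n0 : C `&` p a @` [set r : R | s < r < t] !=set0.
  by exists (p a u); split=> //; exists u.
have [r /= rst e] := gap_lemma hX ps pT cC s0 t1 ns nt n0 Cw.
have [||_ rw] := arc_inj_inner ps _ _ e; first by lra.
  by [].
by move: rst; rewrite rw; case: w_out; lra.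
Qed.

Section Dynamics.
Context (f : X -> X) (cf : continuous f) (mf : mixing f).

Lemma iter_continuous n : continuous (iter n f).
Proof.
elim: n => [|n IH] x; first exact: cvg_id.
by apply: (@continuous_comp _ _ _ (iter n f) f); [exact: IH|exact: cf].
Qed.

Lemma iter_connected n J : connected J -> connected (iter n f @` J).
Proof. exact/connected_image/iter_continuous. Qed.

(** Mixing concerns open sets, but a nondegenerate connected set contains an open subarc. *)
Lemma mixing_hits (J O : set X) : connected J -> nondegenerate J -> open O ->
  O !=set0 -> ev (fun n => (iter n f @` J) `&` O !=set0).
Proof.
move=> cJ [x [y [Jx Jy xy]]] oO O0.
have [a [s [t [s0 st t1 sub]]]] := connected_subarc hX ps pT cJ Jx Jy xy.
have [||N _ NP] := mf (U := p a @` [set r : R | s < r < t]) _ oO _ O0.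
- by apply: (open_subarc hX ps pT); lra.
- by exists (p a ((s + t) / 2)); exists ((s + t) / 2) => //=; lra.
exists N => n /NP [z [[w [r /= rst <-] <-] Oz]]; exists (iter n f (p a r)).
by split=> //; exists (p a r) => //; apply: sub; exists r => //=; lra.
Qed.

(* Three arcs are separated inside one edge.  For large n, the connected set
   [iter n f @` J] meets all the gaps around them, so misses at most one. *)
Lemma absorbing_subarc (a : A) : exists s t : R, [/\ 0 < s, s < t, t < 1 &
  forall J : set X, connected J -> nondegenerate J ->
    ev (fun n => subarc a s t `<=` iter n f @` J)].
Proof.
(* The arcs are [2/10, 3/10], [4/10, 5/10] and [6/10, 7/10]; the free interval of length 1/10 to the
   left of each is the gap to be met. *)
pose lo (k : nat) : R := (2 * k%:R + 2) / 10.
pose hi (k : nat) : R := (2 * k%:R + 3) / 10.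
pose T (k : 'I_3) := subarc a (lo k) (hi k).
have kR (k : 'I_3) : 0 <= (k : nat)%:R :> R /\ (k : nat)%:R <= 2 :> R.
  by rewrite ler0n (ler_nat _ _ 2) -ltnS ltn_ord.
have T_bounds (k : 'I_3) : [/\ 0 < lo k, lo k < hi k & hi k < 1].
  by have := kR k; rewrite /lo /hi => -[? ?]; split; lra.
have cT k : connected (T k) by exact: subarc_connected.
have nT k : nondegenerate (T k).
  by have [? ? ?] := T_bounds k; apply: subarc_nondegenerate => //; exact: ltW.
have cover J : connected J -> nondegenerate J ->
    ev (fun n => forall k l, k != l ->
      T k `<=` iter n f @` J \/ T l `<=` iter n f @` J).
  move=> cJ nJ.
  have hits : ev (fun n => forall i : 'I_3,
      (iter n f @` J) `&` p a @` [set r : R | hi i - 2 / 10 < r < lo i] !=set0).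
    apply: ev_forall => i; have := kR i; rewrite /lo /hi => -[? ?].
    apply: mixing_hits => //; first by apply: (open_subarc hX ps pT); lra.
    exists (p a ((2 * (i : nat)%:R + 3 / 2) / 10)).
    by eexists; last reflexivity; rewrite /=; lra.
  apply: ev_sub hits => n hn k l.
  wlog kl : k l / (k < l)%N.
    move=> h; rewrite neq_ltn => /orP[kl|lk]; first by apply: h => //; rewrite neq_ltn kl.
    by rewrite or_comm; apply: h => //; rewrite neq_ltn lk.
  move=> _; apply: contrapT => /not_orP[].
  move=> /existsNP[_ /not_implyP[[r /= rst <-] nr]].
  move=> /existsNP[_ /not_implyP[[r' /= r'st <-] nr']].
  have [xu [Cu [u /= uI ue]]] := hn l; rewrite -ue in Cu.
  have [xw [Cw [w /= wI we]]] := hn k; rewrite -we in Cw.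
  have klR : (k : nat)%:R + 1 <= (l : nat)%:R :> R by rewrite natr1 ler_nat.
  have := kR k; have := kR l; move: rst r'st uI wI.
  rewrite /lo /hi => rst r'st uI wI [? ?] [? ?].
  (* The point [u] before arc [l] lies between the two missed points, the point [w] before arc [k]
     outside them. *)
  apply: (@gap_contra _ a r r' u w (@iter_connected n J cJ)) => //; try lra.
have [N NP] : ev (fun n => forall i k l : 'I_3, k != l ->
    T k `<=` iter n f @` T i \/ T l `<=` iter n f @` T i).
  by apply: ev_forall => i; exact: cover.
have [|||k0 hk] := @absorbing_index (fun i j n => T j `<=` iter n f @` T i) N.
- by move=> i x Tx; exists x.
- move=> i j k m n h1 h2 x /h2 [y /h1 [z Tz <-] <-]; exists z => //.
  by rewrite iterD.
- by move=> n i k l hn kl; exact: NP.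
have [? ? ?] := T_bounds k0; exists (lo k0), (hi k0); split=> //.
move=> J cJ nJ; apply: (hk (fun n k => T k `<=` iter n f @` J)).
  move=> n j m k h1 h2 x /h2 [y /h1 [z Jz <-] <-]; exists z => //.
  by rewrite iterD.
exact: cover.
Qed.

End Dynamics.

(** All that is kept of the dynamics when deciding which parts of an arc get covered. By [spr_mono],
    whatever is covered once is covered from some time on. *)
Record spreading (C : nat -> set X) : Prop := Spreading {
  spr_conn : forall n, connected (C n);
  spr_closed : forall n, closed (C n);
  spr_nondeg : forall n, nondegenerate (C n);
  spr_hits : forall O, open O -> O !=set0 -> ev (fun n => C n `&` O !=set0);
  spr_mono : forall n, ev (fun m => C n `<=` C m) }.

Section Spread.
Context (C : nat -> set X) (sC : spreading C).

Lemma spr_subarc (a : A) (s t : R) n : subarc a s t `<=` C n ->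
  ev (fun n => subarc a s t `<=` C n).
Proof.
by move=> h; apply: ev_sub (spr_mono sC n) => m; apply: subset_trans.
Qed.

Lemma spr_inner (a : A) (s t : R) : 0 <= s -> s < t -> t <= 1 ->
  ev (fun n => exists r, s < r < t /\ C n (p a r)).
Proof.
move=> s0 st t1; have o := open_subarc hX ps pT a s0 t1.
apply: ev_sub (spr_hits sC o _) => [n [x [Cx [r rst e]]]|].
  by exists r; rewrite e.
by exists (p a ((s + t) / 2)); exists ((s + t) / 2) => //=; lra.
Qed.

(** If the left arc is not eventually covered, [spr_mono] shows that it is never covered. A large
    [C n] meets the gaps before and between the two arcs and misses a point of the left one, so by
    the gap lemma it misses none of the right one. *)
Lemma spr_two (a : A) (s1 t1 s2 t2 : R) : 0 < s1 -> s1 <= t1 -> t1 < s2 ->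
  s2 <= t2 -> t2 < 1 ->
  ev (fun n => subarc a s1 t1 `<=` C n) \/ ev (fun n => subarc a s2 t2 `<=` C n).
Proof.
move=> s10 st1 ts st2 t21.
have [|bad] := pselect (ev (fun n => subarc a s1 t1 `<=` C n)); [by left|right].
have h1 := @spr_inner a 0 s1 (lexx _) s10 (ltac:(lra)).
have h2 := @spr_inner a t1 s2 (ltac:(lra)) ts (ltac:(lra)).
apply: ev_sub (evI h1 h2) => n [[w [w0 Cw]] [u [u0 Cu]]].
apply: contrapT => /existsNP[_ /not_implyP[[r' /= r'st <-] nr']].
apply: bad; apply: (@spr_subarc a s1 t1 n) => _ [r /= rst <-].
apply: contrapT => nr.
apply: (@gap_contra (C n) a r r' u w (@spr_conn C sC n)) => //; try lra.
Qed.

Lemma bad_parameter (a : A) : exists z : R, 0 < z < 1 /\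
  forall s t, 0 < s -> s <= t -> t < 1 -> t < z \/ z < s ->
    ev (fun n => subarc a s t `<=` C n).
Proof.
pose good s t := ev (fun n => subarc a s t `<=` C n).
have [allgood|] := pselect (forall s t, 0 < s -> s <= t -> t < 1 -> good s t).
  by exists (1 / 2); split; [lra|move=> s t s0 st t1 _; exact: allgood].
move=> /existsNP[s0 /existsNP[t0 /not_implyP[s00 /not_implyP[st0]]]].
move=> /not_implyP[t01 bad0].
pose L : set R := [set b | b = s0 \/ (s0 <= b <= t0 /\ good s0 b)].
have Lt0 b : L b -> s0 <= b <= t0 by case=> [->|[]] //; rewrite lexx st0.
have Ls0 : L s0 by left.
have supL : has_sup L.
  by split; [exists s0|exists t0 => b /Lt0/andP[]].
have z_s0 : s0 <= sup L by exact: (sup_upper_bound supL).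
have z_t0 : sup L <= t0.
  by apply: ge_sup; [exists s0|move=> b /Lt0/andP[]].
exists (sup L); split; first by lra.
move=> s t s_gt0 st t_lt1 [tz|zs].
  have [b Lb] := sup_adherent (ltac:(lra) : 0 < sup L - t) supL.
  rewrite opprB addrCA subrr addr0 => tb.
  have [[bs0 bt0] gb] : (s0 <= b /\ b <= t0) /\ (b = s0 \/ good s0 b).
    by have /andP[? ?] := Lt0 b Lb; split=> //; case: Lb => [|[]]; [left|right].
  (* Were the arc from [(t + b) / 2] to [t0] good, it would overlap the good arc from [s0] to [b]
     and make the initial bad arc good. *)
  have [|||||//|g] := @spr_two a s t ((t + b) / 2) t0; try lra.
  case: bad0; case: gb => [bs|gb].
    apply: ev_sub g => n; apply: subset_trans => x [r /= rst <-]; exists r => //=.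
    by lra.
  apply: ev_sub (evI gb g) => n [h1 h2] x [r /= rst <-].
  have [rb|br] := leP r b; [apply: h1|apply: h2]; exists r => //=; lra.
pose b := Num.min ((sup L + s) / 2) t0.
have bs : b < s by rewrite /b gt_min; apply/orP; left; lra.
have sb : s0 <= b by rewrite /b le_min st0 andbT; lra.
have nb : ~ good s0 b.
  rewrite /b; case: leP => [h g|_ //].
  have : (sup L + s) / 2 <= sup L.
    apply: (sup_upper_bound supL).
    by right; split=> //; lra.
  by lra.
by have [|||||//|] := @spr_two a s0 b s t.
Qed.

End Spread.
End Core.

(** * Subdivision *)

Section Subdivision.
Context (R : realType) (X : metricType R).
Context (A W : finType) (v : A -> bool -> W) (p : A -> R -> X).
Context (ps : arc_system v p) (pT : arc_union p = [set: X]).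
Context (vv : forall a, v a false <> v a true).
Context (z : A -> R) (z01 : forall a, 0 < z a < 1).

(* The arc [a] is cut at the parameter [z a] into two arcs oriented towards the
   cut; the original ends are thus [inl] vertices and the cuts [inr] ones. *)
Definition half_param (e : A * bool) (t : R) : R :=
  if e.2 then 1 - (1 - z e.1) * t else z e.1 * t.
Definition half_arc (e : A * bool) (t : R) : X := p e.1 (half_param e t).
Definition half_vertex (e : A * bool) (i : bool) : W + A :=
  if i then inr e.1 else inl (v e.1 e.2).

Lemma half_param01 e t : 0 <= t <= 1 -> 0 <= half_param e t <= 1.
Proof.
move=> t01; have := z01 e.1; rewrite /half_param; case: e.2 => z'; by nra.
Qed.

Lemma half_arc_system : arc_system half_vertex half_arc.
Proof.
split.
- move=> e t; apply: (@continuous_comp _ _ _ (half_param e) (p e.1)).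
    rewrite /half_param; case: e.2.
      apply: cvgB; first exact: cvg_cst.
      by apply: cvgM; [exact: cvg_cst|exact: cvg_id].
    by apply: cvgM; [exact: cvg_cst|exact: cvg_id].
  exact: (arc_cont ps).
- have e1 (c : A) (d : bool) : half_arc (c, d) 1 = p c (z c).
    by rewrite /half_arc /half_param; case: d; rewrite /= mulr1 // subKr.
  move=> [a b] [a' b'] [] [] //= [].
    by move=> aa; rewrite !e1 aa.
  move=> h; have e (c : A) (d : bool) : half_arc (c, d) 0 = p c d%:R.
    by rewrite /half_arc /half_param; case: d; rewrite /= mulr0 ?subr0.
  by rewrite !e; exact: (arc_vertex ps).
move=> [a b] [a' b'] t s t01 s01.
move=> /(arc_inj ps (half_param01 _ t01) (half_param01 _ s01)) /=.
have end0 c d (r : R) (i : bool) : 0 <= r <= 1 -> half_param (c, d) r = i%:R ->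
    r = 0 /\ d = i.
  move=> r01; have := z01 c; rewrite /half_param /=.
  by case: d; case: i => /= zc h; split=> //; nra.
case=> [[<- e]|[i [j [e1 e2 h]]]]; last first.
  have [-> bi] := end0 _ _ _ _ t01 e1; have [-> bj] := end0 _ _ _ _ s01 e2.
  by right; exists false, false; split=> //; rewrite /half_vertex /= bi bj h.
move: e; have := z01 a; rewrite /half_param /=.
case: b; case: b' => /= za e.
- left; split=> //; nra.
- by right; exists true, true; split=> //=; nra.
- by right; exists true, true; split=> //=; nra.
left; split=> //; nra.
Qed.

Lemma half_arc_union : arc_union half_arc = [set: X].
Proof.
apply/seteqP; split=> // x _; have [a [t [t01 ->]]] := arcP pT x.
have za := z01 a; have [tz|zt] := leP t (z a).
  exists (a, false), (t / z a); split.
    by rewrite divr_ge0 ?ler_pdivrMr /=; lra.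
  have za0 : z a != 0 by rewrite gt_eqF //; lra.
  by rewrite /half_arc /half_param /= mulrC divfK.
exists (a, true), ((1 - t) / (1 - z a)); split.
  by rewrite divr_ge0 ?ler_pdivrMr /=; lra.
have za1 : 1 - z a != 0 by rewrite gt_eqF //; lra.
by rewrite /half_arc /half_param /= mulrC divfK // subKr.
Qed.

Lemma half_bipartite e e' : half_vertex e false != half_vertex e' true.
Proof. by []. Qed.

(** A common cut forces the same original arc, and its two halves start at different vertices
    because no arc is a loop. *)
Lemma half_simple e e' : half_vertex e false = half_vertex e' false ->
  half_vertex e true = half_vertex e' true -> e = e'.
Proof.
case: e e' => [a b] [a' b'] /= [h] [aa]; rewrite aa in h *; congr pair.
case: b h; case: b' => // h; first by case: (vv (esym h)).
by case: (vv h).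
Qed.

Lemma half_spread (C : nat -> set X) e (s t : R) :
  (forall a s t, 0 < s -> s <= t -> t < 1 -> t < z a \/ z a < s ->
    ev (fun n => subarc p a s t `<=` C n)) ->
  0 < s -> s <= t -> t < 1 -> ev (fun n => subarc half_arc e s t `<=` C n).
Proof.
move=> zC s0 st t1; case: e => a b; have za := z01 a.
have [u [w [u0 uw w1 uwz sub]]] : exists u w : R, [/\ 0 < u, u <= w, w < 1,
    w < z a \/ z a < u & forall r, s <= r <= t -> u <= half_param (a, b) r <= w].
  rewrite /half_param /=; case: b.
    by exists (1 - (1 - z a) * t), (1 - (1 - z a) * s); split;
      [nra|nra|nra|right; nra|move=> r rst; nra].
  by exists (z a * s), (z a * t); split; [nra|nra|nra|left; nra|move=> r rst; nra].
apply: ev_sub (zC a u w u0 uw w1 uwz) => n h _ [r /= rst <-].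
by apply: h; exists (half_param (a, b) r) => //; exact: sub.
Qed.

End Subdivision.

(** Supplies subgraphs against which inaccessibility is tested. *)
Lemma subarc_graph (R : realType) (X : metricType R) (A W : finType)
    (v : A -> bool -> W) (p : A -> R -> X) (ps : arc_system v p) a (s t : R) :
  0 < s -> s < t -> t < 1 -> is_graph (subarc p a s t).
Proof.
move=> s0 st t1.
pose q (_ : unit) (r : R) := p a (s + clamp r * (t - s)).
have qs : arc_system (fun (_ : unit) (b : bool) => b) q.
  split.
  + move=> i r; apply: (@continuous_comp _ _ _ (fun r => s + clamp r * (t - s)) (p a)).
      apply: cvgD; first exact: cvg_cst.
      by apply: cvgM; [exact: clamp_continuous|exact: cvg_cst].
    exact: (arc_cont ps).
  + by move=> [] [] i j ->.
  move=> [] [] r r' r01 r'01 /(arc_inj_inner ps) [||_]; rewrite ?clamp_id //; try nra.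
  by move=> e; left; split=> //; nra.
have <- : arc_union q = subarc p a s t.
  apply/seteqP; split=> x.
    move=> [u [r [r01 ->]]]; exists (s + clamp r * (t - s)) => //=.
    by rewrite clamp_id //; nra.
  move=> [r /= rst <-]; have ts0 : t - s != 0 by rewrite gt_eqF //; lra.
  have r01 : 0 <= (r - s) / (t - s) <= 1.
    by rewrite divr_ge0 ?ler_pdivrMr ?mul1r; lra.
  exists tt, ((r - s) / (t - s)); split=> //.
  by rewrite /q clamp_id // divfK // addrC subrK.
apply: (arc_union_graph qs _ _ tt) => //; first by case=> [] [].
rewrite (_ : arc_union q = q tt @` [set r : R | 0 <= r <= 1]).
  apply: connected_image; first exact: (arc_cont qs).
  by apply: convex_connected => x y r /=; lra.
apply/seteqP; split=> x; first by move=> [[] [r [r01 ->]]]; exists r.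
by move=> [r r01 <-]; exists tt, r.
Qed.

(* Each arc is cut at the one parameter that the iterates of [C0] may never cover
   from both sides. *)
Lemma spreading_subdivision (R : realType) (X : metricType R) (f : X -> X) :
  is_graph [set: X] -> continuous f -> mixing f ->
  exists (A W : finType) (v : A -> bool -> W) (p : A -> R -> X) (C0 : set X),
  [/\ [/\ arc_system v p, arc_union p = [set: X],
        forall a b, v a false != v b true,
        forall a b, v a false = v b false -> v a true = v b true -> a = b &
        exists a : A, True],
      [/\ is_graph C0, spreading (fun n => iter n f @` C0) &
        forall J, connected J -> nondegenerate J ->
          ev (fun n => C0 `<=` iter n f @` J)] &
      forall a (s t : R), 0 < s -> s <= t -> t < 1 ->
        ev (fun n => subarc p a s t `<=` iter n f @` C0)].
Proof.
move=> gX cf mf.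
have [A [W [v [p [ps pT vv [a0 _]]]]]] := graph_arc_system gX.
have [s [t [s0 st t1 abs]]] := absorbing_subarc ps pT cf mf a0.
pose C0 := subarc p a0 s t.
have cC0 : connected C0 := @subarc_connected _ _ _ _ _ _ ps _ _ _.
have nC0 : nondegenerate C0 by apply: (subarc_nondegenerate ps) => //; exact: ltW.
have cC n : connected (iter n f @` C0) by exact: iter_connected.
have step n m : C0 `<=` iter m f @` C0 ->
    iter n f @` C0 `<=` iter (n + m) f @` C0.
  by move=> h _ [x /h [y C0y <-] <-]; exists y; rewrite // iterD.
have [K KC] := abs C0 cC0 nC0.
have hits O : open O -> O !=set0 -> ev (fun n => (iter n f @` C0) `&` O !=set0).
  exact: (mixing_hits ps pT mf cC0 nC0).
have mono n : ev (fun m => iter n f @` C0 `<=` iter m f @` C0).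
  exists (n + K)%N => m hm; have -> : m = (n + (m - n))%N by lia.
  by apply: step; apply: KC; lia.
(* [C0] lies in its image under [iter (M + n) f], so [iter n f] cannot collapse [C0] to a point. *)
have nC n : nondegenerate (iter n f @` C0).
  have [x [y [Cx Cy xy]]] := nC0; have [m hm] := ev_ex (abs C0 cC0 nC0).
  have [M MP] := abs C0 cC0 nC0.
  have /(_ _ Cx) [x' C0x' xE] := MP (M + n)%N (leq_addr _ _).
  have /(_ _ Cy) [y' C0y' yE] := MP (M + n)%N (leq_addr _ _).
  exists (iter n f x'), (iter n f y'); split; [by exists x'|by exists y'|].
  by move=> e; apply: xy; rewrite -xE -yE !iterD e.
have clC n : closed (iter n f @` C0).
  apply: compact_closed; first exact: metric_hausdorff.
  apply: continuous_compact; first exact/continuous_subspaceT/iter_continuous.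
  apply: continuous_compact; last exact: seg_compact.
  exact/continuous_subspaceT/(arc_cont ps).
have sC : spreading (fun n => iter n f @` C0) by [].
have /choice [z zP] := bad_parameter ps pT sC.
have z01 a : 0 < z a < 1 by have [] := zP a.
exists (A * bool)%type, (W + A)%type, (half_vertex v), (half_arc p z), C0; split.
- split.
  + exact: half_arc_system.
  + exact: half_arc_union.
  + exact: half_bipartite.
  + exact: half_simple.
  by exists (a0, true).
- split=> //.
  exact: (subarc_graph ps).
by move=> e s' t'; apply: half_spread => // a; have [] := zP a.
Qed.

(** * Germs at vertices *)

Lemma closed_right_limit (R : realType) (F : set R) (w : R) : closed F -> 0 < w ->
  (forall r, 0 < r -> r < w -> F r) -> F 0.
Proof.
move=> cF w0 hF; apply: contrapT => nF.
have /nbhs_ballP [d /= d0 sub] : nbhs (0 : R) (~` F).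
  by apply: open_nbhs_nbhs; split=> //; exact: closed_openC.
have m0 : 0 < Num.min d w by rewrite lt_min d0 w0.
have md : Num.min d w <= d by rewrite ge_min lexx.
have mw : Num.min d w <= w by rewrite ge_min lexx orbT.
apply: (sub (Num.min d w / 2)); last by apply: hF; lra.
by rewrite /ball /= sub0r normrN gtr0_norm; lra.
Qed.

Lemma near_right (R : realType) (P : set R) : nbhs (0 : R) P ->
  exists2 d : R, 0 < d & forall r, 0 <= r -> r < d -> P r.
Proof.
move=> /nbhs_ballP [d /= d0 sub]; exists d => // r r0 rd; apply: sub.
by rewrite /ball /= sub0r normrN ger0_norm.
Qed.

Lemma finite_min (R : realType) (I : finType) (d : I -> R) : (forall i, 0 < d i) ->
  exists2 e : R, 0 < e & forall i, e <= d i.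
Proof.
move=> d0; exists (\big[Num.min/1]_i d i); first by rewrite lt_bigmin.
by move=> i; rewrite bigmin_le_cond.
Qed.

Lemma graph_nondegenerate (R : realType) (Y : metricType R) (J : set Y) :
  is_graph J -> nondegenerate J.
Proof.
move=> [_ _ [n [K [h [sc [_ [s sK s2]] [hb _]]]]]].
move/eqP/cards2P: s2 => [i [j [ij sE]]]; rewrite sE in sK.
have [hf hi _] := hb.
have c0 : carrier K (segment i j 0 : 'rV[R]_n).
  by apply: segment_carrier => //; rewrite lexx ler01.
have c1 : carrier K (segment i j 1 : 'rV[R]_n).
  by apply: segment_carrier => //; rewrite lexx ler01.
exists (h (segment i j 0)), (h (segment i j 1)); split; [exact: hf|exact: hf|].
move/hi; rewrite !inE => /(_ c0 c1).
move/(congr1 (fun y : 'rV[R]_n => y ord0 i)); rewrite !segmentE eqxx (negbTE ij).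
by move=> /eqP; rewrite /= subr0 subrr !mulr1 !mulr0 !addr0 oner_eq0.
Qed.

Section Germs.
Context (R : realType) (X : metricType R).
Context (A W : finType) (v : A -> bool -> W) (p : A -> R -> X).
Context (ps : arc_system v p) (pT : arc_union p = [set: X]).

Let hX : hausdorff_space X := @metric_hausdorff _ X.

Lemma germ_continuous e : continuous (germ p e).
Proof.
case: e => a []; last exact: (arc_cont ps a).
have -> : germ p (a, true) = p a \o (fun t => 1 - t) by [].
move=> t; apply: continuous_comp; last exact: (arc_cont ps).
by apply: cvgB; [exact: cvg_cst|exact: cvg_id].
Qed.

Lemma germ_image e (s t : R) : germ p e @` [set r : R | s < r < t] =
  p e.1 @` [set r : R | (if e.2 then 1 - t else s) < r < if e.2 then 1 - s else t].
Proof.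
case: e => a [] /=; rewrite /germ //=; apply/seteqP; split=> x [r /= rst <-].
  by exists (1 - r) => //=; lra.
by exists (1 - r) => /=; [lra|rewrite opprB addrC subrK].
Qed.

Lemma germ_inj_inner e e' (t s : R) : 0 < t < 1 -> 0 <= s <= 1 ->
  germ p e t = germ p e' s ->
  e.1 = e'.1 /\ (if e.2 then 1 - t else t) = if e'.2 then 1 - s else s.
Proof.
move=> t01 s01; rewrite /germ => /(arc_inj_inner ps); apply.
  by case: e.2; lra.
by case: e'.2; lra.
Qed.

Lemma germ_gap (S : set X) e (s t : R) : connected S -> 0 <= s -> t <= 1 ->
  ~ S (germ p e s) -> ~ S (germ p e t) ->
  S `&` germ p e @` [set r : R | s < r < t] !=set0 ->
  S `<=` germ p e @` [set r : R | s < r < t].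
Proof.
rewrite germ_image /germ => cS s0 t1; case: e => a [] /= ns nt n0.
  by apply: (gap_lemma hX ps pT cS) => //; lra.
exact: (gap_lemma hX ps pT cS).
Qed.

Lemma arc_point_cases (x : X) :
  (exists a (t : R), 0 < t < 1 /\ x = p a t) \/ exists e, x = germ p e 0.
Proof.
have [a [t [t01 ->]]] := arcP pT x.
have [->|t0] := eqVneq t 0; first by right; exists (a, false).
have [->|t1] := eqVneq t 1; first by right; exists (a, true); rewrite germ0.
by left; exists a, t; split=> //; rewrite !lt_neqAle t1 eq_sym t0.
Qed.

Section SpreadGerms.
Context (C : nat -> set X) (sC : spreading C).
Context (innerC : forall a (s t : R), 0 < s -> s <= t -> t < 1 ->
  ev (fun n => subarc p a s t `<=` C n)).

(* The bound 1/2 is arbitrary: by [innerC] any smaller germ would do. *)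
Definition covered_germ (e : A * bool) : Prop :=
  ev (fun n => forall t, 0 <= t <= 1 / 2 -> C n (germ p e t)).

Lemma germ_inner_covered e (s t : R) : 0 < s -> s <= t -> t < 1 ->
  ev (fun n => forall r, s <= r <= t -> C n (germ p e r)).
Proof.
move=> s0 st t1; case: e => a [].
  have := @innerC a (1 - t) (1 - s).
  case=> [|||N NP]; [lra|lra|lra|exists N => n /NP h r rst].
  by apply: h; exists (1 - r) => //=; lra.
have [N NP] := @innerC a s t s0 st t1; exists N => n /NP h r rst.
by apply: h; exists r.
Qed.

(** Every [C m] misses points of the germ arbitrarily close to its start: otherwise closedness and
    [innerC] would make the germ covered. For a large [C m], a point of the germ before the missed
    [u] would sit between two missed points, although [C m] also has a point beyond them. *)
Lemma uncovered_germ e n : ~ covered_germ e ->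
  exists u : R, [/\ 0 < u, u <= 1 / 2 & forall t, 0 < t -> t < u ->
    ~ C n (germ p e t)].
Proof.
move=> ne.
have miss m (w : R) : 0 < w -> w <= 1 / 2 ->
    exists t, [/\ 0 < t, t < w & ~ C m (germ p e t)].
  move=> w0 w1; apply: contrapT => h; apply: ne.
  have Cm t : 0 < t -> t < w -> C m (germ p e t).
    by move=> t0 tw; apply: contrapT => nC; apply: h; exists t.
  have Cm0 : C m (germ p e 0).
    apply: (@closed_right_limit R (germ p e @^-1` C m) w) => //.
    apply: ((continuous_closedP (germ p e)).1); first exact: germ_continuous.
    exact: spr_closed.
  have h2 : ev (fun n => forall r, w / 2 <= r <= 1 / 2 -> C n (germ p e r)).
    by apply: germ_inner_covered; lra.
  apply: ev_sub (evI (spr_mono sC m) h2) => k [mk Ck] t t01.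
  have [t0|t0] := eqVneq t 0; first by rewrite t0; exact: mk.
  have [tw|wt] := ltP t w; last by apply: Ck; lra.
  by apply/mk/Cm => //; rewrite lt_neqAle eq_sym t0; lra.
(* The parameter 3/4 is any inner one beyond 1/2, hence outside every gap considered here. *)
have h2 : ev (fun n => forall r : R, 3 / 4 <= r <= 3 / 4 -> C n (germ p e r)).
  by apply: germ_inner_covered; lra.
have [m [nm Cm]] := ev_ex (evI (spr_mono sC n) h2).
have [u [u0 u1 nu]] := miss m (1 / 2) (ltac:(lra)) (lexx _).
exists u; split=> //; first by lra.
move=> t t0 tu /nm Ct; have [t' [t'_gt0 t't nt']] := miss m t t0 (ltac:(lra)).
have n0 : C m `&` germ p e @` [set r : R | t' < r < u] !=set0.
  by exists (germ p e t); split=> //; exists t => //=; lra.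
have C34 : C m (germ p e (3 / 4)) by apply: Cm; lra.
have t'0 : 0 <= t' by exact: ltW.
have u1' : u <= 1 by lra.
have [r /= rI e'] := germ_gap (@spr_conn _ _ C sC m) t'0 u1' nt' nu n0 C34.
have [||_] := germ_inj_inner _ _ e'; first by lra.
  by lra.
by move: rI; case: e.2 => rI h; lra.
Qed.

End SpreadGerms.
End Germs.

(** * The blown-up graph *)

Section BlowUp.
Context (R : realType) (X X' : metricType R).
Context (A W : finType) (v : A -> bool -> W) (p : A -> R -> X).
Context (ps : arc_system v p) (pT : arc_union p = [set: X]) (a0 : A).
Context (f : X -> X) (cf : continuous f) (C0 : set X).

Let C n : set X := iter n f @` C0.

Context (sC : spreading C).
Context (absC : forall J, connected J -> nondegenerate J ->
  ev (fun n => C0 `<=` iter n f @` J)).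
Context (innerC : forall a (s t : R), 0 < s -> s <= t -> t < 1 ->
  ev (fun n => subarc p a s t `<=` C n)).

Let cov e := covered_germ p C e.

(** An uncovered end becomes a vertex shared with no other end. [X'] stands for any space spanned by
    arcs with these vertices; it is realised only at the end. *)
Definition blown_vertex (a : A) (i : bool) : W + A * bool :=
  if `[< covered_germ p C (a, i) >] then inl (v a i) else inr (a, i).
Notation v' := blown_vertex.

Context (p' : A -> R -> X') (ps' : arc_system v' p').
Context (pT' : arc_union p' = [set: X']).
Context (pi : X' -> X) (cpi : continuous pi).
Context (piE : forall a (t : R), 0 <= t <= 1 -> pi (p' a t) = p a t).

Let hX : hausdorff_space X := @metric_hausdorff _ X.
Let hX' : hausdorff_space X' := @metric_hausdorff _ X'.

Lemma blown_covered e : cov e -> vend v' e = inl (vend v e).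
Proof. by case: e => a i; rewrite /vend /blown_vertex /= => /asboolT ->. Qed.

Lemma blown_uncovered e : ~ cov e -> vend v' e = inr e.
Proof. by case: e => a i; rewrite /vend /blown_vertex /= => /asboolF ->. Qed.

Lemma blown_covered_eq e e' : cov e -> vend v' e' = vend v' e -> cov e'.
Proof.
move=> ce; rewrite (blown_covered ce) => h; apply: contrapT => ne'.
by move: h; rewrite (blown_uncovered ne').
Qed.

Lemma blown_uncovered_eq e e' : ~ cov e -> vend v' e' = vend v' e -> e' = e.
Proof.
move=> ce; rewrite (blown_uncovered ce); have [ce'|ce'] := pselect (cov e').
  by rewrite (blown_covered ce').
by rewrite (blown_uncovered ce') => -[].
Qed.

Lemma pi_germ e t : 0 <= t <= 1 -> pi (germ p' e t) = germ p e t.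
Proof. by move=> t01; rewrite /germ piE //; case: e.2; lra. Qed.

Definition tip (e : A * bool) : X' := germ p' e 0.
Definition tips : set X' := [set x | exists e, ~ cov e /\ x = tip e].

Lemma tip_inj e e' : ~ cov e -> tip e' = tip e -> e' = e.
Proof. by move=> ne /(germ0_inj ps'); exact: blown_uncovered_eq. Qed.

Lemma inner_not_tip a t : 0 < t < 1 -> ~ tips (p' a t).
Proof.
move=> t01 [e [_]]; rewrite /tip germ0 => /(arc_inj_inner ps') [//||_ te].
  by case: e.2; rewrite ?lexx ler01.
by move: t01; rewrite te; case: e.2; rewrite ltxx ?andbF.
Qed.

Lemma covered_not_tip e t : cov e -> 0 <= t < 1 -> ~ tips (germ p' e t).
Proof.
move=> ce t01; have [->|t0] := eqVneq t 0.
  move=> [e' [ne']]; rewrite -/(tip e) => /(tip_inj ne') ee'.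
  by apply: ne'; rewrite -ee'.
apply: inner_not_tip; have : 0 < t by rewrite lt_neqAle eq_sym t0; lra.
by case: e.2; lra.
Qed.

Lemma not_tip_cases x : ~ tips x ->
  (exists a (t : R), 0 < t < 1 /\ x = p' a t) \/ exists e, cov e /\ x = tip e.
Proof.
move=> nx; have [?|[e xe]] := arc_point_cases pT' x; [by left|right].
by exists e; split=> //; apply: contrapT => ne; apply: nx; exists e.
Qed.

(** Vertices are separated only along uncovered ends, so a vertex of [X] has at most one preimage
    that is not a tip. *)
Lemma pi_inj x y : ~ tips x -> ~ tips y -> pi x = pi y -> x = y.
Proof.
have b01 (b : bool) : 0 <= (b%:R : R) <= 1 by case: b; rewrite lexx ler01.
move=> /not_tip_cases [[a [t [t01 ->]]]|[e [ce ->]]]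
  /not_tip_cases [[b [s [s01 ->]]]|[e' [ce' ->]]].
- rewrite !piE; [|by lra|by lra].
  by move=> /(arc_inj_inner ps) [//|| -> ->] //; lra.
- rewrite /tip germ0 !piE //; last by lra.
  move=> /(arc_inj_inner ps) [//|//|_ te].
  by move: t01; rewrite te; case: e'.2; rewrite ltxx ?andbF.
- rewrite /tip germ0 !piE //; last by lra.
  move=> /esym /(arc_inj_inner ps) [//|//|_ te].
  by move: s01; rewrite te; case: e.2; rewrite ltxx ?andbF.
rewrite !pi_germ ?lexx ?ler01 // => /(germ0_inj ps) h.
rewrite /tip !germ0; apply: (arc_vertex ps').
by have := blown_covered ce; rewrite h -(blown_covered ce').
Qed.

(** If all germs at [x] were uncovered, [C n] would miss a punctured neighbourhood of [x], and being
    connected it would reduce to [x]. *)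
Lemma vertex_covered n x e : C n x -> x = germ p e 0 ->
  exists e', cov e' /\ x = germ p e' 0.
Proof.
move=> Cx xe; apply: contrapT => no.
have nc e' : vend v e' = vend v e -> ~ cov e'.
  move=> h ce'; apply: no; exists e'; split=> //.
  by rewrite xe !germ0; exact/esym/(arc_vertex ps).
have /choice [u uP] e' : exists u : R, 0 < u /\
    (~ cov e' -> forall t, 0 < t -> t < u -> ~ C n (germ p e' t)).
  have [ce|ne] := pselect (cov e'); first by exists 1.
  by have [u [u0 _ h]] := uncovered_germ ps pT sC innerC n ne; exists u.
have [O [oO Ox OP]] := vertex_nbhd hX ps pT e (fun e' => (uP e').1).
have CO y : C n y -> O y -> y = x.
  move=> Cy /OP [e' [t [ve' t01 tu yE]]]; have [u0 /(_ (nc _ ve')) nu] := uP e'.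
  have [t0|t0] := eqVneq t 0.
    by rewrite yE t0 xe !germ0; exact: (arc_vertex ps).
  case: (nu t); rewrite -?yE // lt_neqAle eq_sym t0; lra.
have sub : C n `<=` O.
  apply: (connected_clopen (@spr_conn _ _ C sC n) oO (@arc_closed1 X hX x)).
    apply/seteqP; split=> y [Cy]; first by move=> /(CO _ Cy) ->.
    by move=> /= ->; split=> //; rewrite xe.
  by exists x; split=> //; rewrite xe.
have [y [z [Cy Cz yz]]] := spr_nondeg sC n; apply: yz.
by rewrite (CO y Cy (sub _ Cy)) (CO z Cz (sub _ Cz)).
Qed.

Lemma pi_lift n x : C n x -> exists y, ~ tips y /\ pi y = x.
Proof.
move=> Cx; have [[a [t [t01 xE]]]|[e xE]] := arc_point_cases pT x.
  exists (p' a t); split; first exact: inner_not_tip.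
  by rewrite piE ?xE //; lra.
have [e' [ce' xE']] := vertex_covered Cx xE.
exists (tip e'); split; last by rewrite /tip pi_germ ?lexx ?ler01.
by apply: covered_not_tip => //; lra.
Qed.

Definition lifted n : set X' := [set y | ~ tips y /\ C n (pi y)].

(** Deleting the tips preserves closedness since by [uncovered_germ] the lift of [C n] stays away
    from each of them. *)
Lemma lifted_closed n : closed (lifted n).
Proof.
have /choice [u uP] e : exists u : R, 0 < u /\
    (~ cov e -> forall t, 0 < t -> t < u -> ~ C n (germ p e t)).
  have [ce|ne] := pselect (cov e); first by exists 1.
  by have [u [u0 _ h]] := uncovered_germ ps pT sC innerC n ne; exists u.
have /choice [O OP] e := vertex_nbhd hX' ps' pT' e (fun e' => (uP e').1).
have oC : open (~` lifted n).
  rewrite (_ : ~` _ = pi @^-1` (~` C n) `|`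
      \bigcup_(e in [set e | ~ cov e]) O e); last first.
    apply/seteqP; split=> y.
      move=> ny; have [Cy|] := pselect (C n (pi y)); last by left.
      right; have [e [ne ->]] : tips y by apply: contrapT => h; apply: ny.
      by exists e => //; have [_ ? _] := OP e.
    move=> [nC|[e ne Oy]] [nt Cy]; first exact: nC.
    have [_ _ /(_ _ Oy) [e' [t [ve' t01 tu yE]]]] := OP e.
    have ee := blown_uncovered_eq ne ve'; subst e'.
    have [t0|t0] := eqVneq t 0; first by apply: nt; exists e; rewrite yE t0.
    have [_ /(_ ne t)] := uP e; apply=> //.
      by rewrite lt_def t0; case/andP: t01.
    by rewrite -(pi_germ e) -?yE.
  apply: openU.
    apply: ((continuousP pi).1 cpi); apply: closed_openC.
    exact: (@spr_closed _ _ C sC n).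
  by apply: bigcup_open => e _; have [] := OP e.
by rewrite -[lifted n]setCK; exact: open_closedC.
Qed.

Lemma lifted_compact n : compact (lifted n).
Proof.
apply: (@subclosed_compact _ _ [set: X']) => //; first exact: lifted_closed.
by rewrite -pT'; apply: arc_union_compact; exact: (arc_cont ps').
Qed.

Lemma covered_germs : ev (fun n => forall e, cov e ->
  forall t, 0 <= t <= 1 / 2 -> C n (germ p e t)).
Proof.
apply: ev_forall => e; have [ce|ne] := pselect (cov e); last by exists 0%N.
by apply: ev_sub ce => n h _.
Qed.

(** At a vertex of [X'] that is not a tip, all remaining germs are covered. *)
Lemma lifted_nbhs x : ~ tips x -> ev (fun n => nbhs x (lifted n)).
Proof.
move=> /not_tip_cases [[a [t [t01 ->]]]|[e [ce ->]]].
  have [|||N NP] := @innerC a (t / 2) ((1 + t) / 2); [lra|lra|lra|].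
  exists N => n /NP sub; rewrite nbhsE.
  exists (p' a @` [set r : R | t / 2 < r < (1 + t) / 2]).
    split; last by exists t => //=; lra.
    by apply: (open_subarc hX' ps' pT'); lra.
  move=> _ [r /= rst <-]; split; first by apply: inner_not_tip; lra.
  by rewrite piE; [apply: sub; exists r => //=; lra|lra].
have [|O [oO Ox OP]] := vertex_nbhd hX' ps' pT' e (u := fun=> 1 / 2).
  by move=> _; lra.
apply: ev_sub covered_germs => n Cn; rewrite nbhsE; exists O => //.
move=> y /OP [e' [t [ve' t01 t2 ->]]].
have ce' := blown_covered_eq ce ve'; split.
  by apply: covered_not_tip => //; lra.
by rewrite pi_germ //; apply: Cn => //; lra.
Qed.

Lemma iterate_succ n x : C n x -> C n.+1 (f x).
Proof. by move=> [y Cy <-]; exists y. Qed.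

Lemma lift_map_exists : exists g0 : X' -> X',
  forall x, ~ tips x -> ~ tips (g0 x) /\ pi (g0 x) = f (pi x).
Proof.
have /choice [g0 g0P] x : exists y, ~ tips x -> ~ tips y /\ pi y = f (pi x).
  have [tx|nx] := pselect (tips x); first by exists x.
  have [n /nbhs_singleton [_ Cn]] := ev_ex (lifted_nbhs nx).
  by have [y yP] := pi_lift (iterate_succ Cn); exists y.
by exists g0.
Qed.

(** * The lift and its limits at the tips *)

Section LiftMap.
Context (g0 : X' -> X')
  (g0P : forall x, ~ tips x -> ~ tips (g0 x) /\ pi (g0 x) = f (pi x)).

Lemma lift_map_continuous x : ~ tips x -> {for x, continuous g0}.
Proof.
move=> nx P; rewrite nbhsE => -[O [oO Ox] OP].
have [n nn] := ev_ex (lifted_nbhs nx).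
(* Near [x] the values of [g0] stay in the compact [lifted n.+1]. [T] is the closed set of points
   that [f \o pi] sends to images of the part outside [O]; injectivity of [pi] off the tips keeps
   [x] out of it. *)
pose T := (f \o pi) @^-1` (pi @` (lifted n.+1 `&` ~` O)).
have cT : closed T.
  apply: ((continuous_closedP (f \o pi)).1).
    by move=> y; apply: continuous_comp; [exact: cpi|exact: cf].
  apply: compact_closed => //; apply: continuous_compact.
    exact: continuous_subspaceT.
  apply: compact_closedI; first exact: lifted_compact.
  exact: open_closedC.
have nT : ~ T x.
  move=> [w [[nw _] nO] e]; apply: nO; rewrite (_ : w = g0 x) //.
  by have [? e'] := g0P nx; apply: pi_inj => //; rewrite e'.
have nbT : nbhs x (~` T) by apply: open_nbhs_nbhs; split=> //; exact: closed_openC.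
apply: filterS (filterI nn nbT) => y [[ny Cy] nTy]; apply: OP.
apply: contrapT => nO; apply: nTy; have [? e] := g0P ny.
by exists (g0 y) => //; split=> //; split=> //; rewrite e; exact: iterate_succ.
Qed.

Definition tends e e' := forall r : R, 0 < r -> r < 1 -> exists2 d : R, 0 < d &
  forall t, 0 < t -> t < d ->
    exists s : R, [/\ 0 < s, s < r & g0 (germ p' e t) = germ p' e' s].

(** The weak form of [tends], asking only for arbitrarily small pairs of parameters;
    [clusters_tends] upgrades it. *)
Definition clusters e e' := forall d : R, 0 < d -> exists t s : R,
  [/\ 0 < t < d, 0 < s < d & g0 (germ p' e t) = germ p' e' s].

Lemma uncovered_cover (d : R) : 0 < d -> d < 1 / 2 -> exists n, forall y,
  ~ tips y -> ~ lifted n y -> exists e (t : R), [/\ ~ cov e, 0 < t < d & y = germ p' e t].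
Proof.
move=> d0 d2.
have h1 : ev (fun n => forall a, subarc p a d (1 - d) `<=` C n).
  by apply: ev_forall => a; apply: innerC; lra.
have [n [Cd Cc]] := ev_ex (evI h1 covered_germs); exists n => y ny nl.
have {}nl : ~ C n (pi y) by move=> ?; apply: nl.
case: (not_tip_cases ny) => [[a [t [t01 yE]]]|[e [ce yE]]]; last first.
  case: nl; rewrite yE /tip pi_germ ?lexx ?ler01 //.
  by apply: Cc => //; lra.
rewrite yE piE in nl; last by lra.
have [td|dt] := ltP t d.
  exists (a, false), t; split=> //; last by lra.
  move=> ce; apply: nl; apply: (Cc (a, false) ce); lra.
have [t1|t1] := leP t (1 - d).
  by case: nl; apply: Cd; exists t => //=; lra.
have yE' : y = germ p' (a, true) (1 - t) by rewrite yE /germ /= subKr.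
exists (a, true), (1 - t); split=> //; last by lra.
move=> ce; apply: nl.
have -> : p a t = germ p (a, true) (1 - t) by rewrite /germ /= subKr.
by apply: Cc => //; lra.
Qed.

(** A point of the germ [e'] outside [C n.+1] still lies in a later [C l.+1], hence has a preimage
    in [C l]. That preimage is not in [C n], so it lies in a short uncovered germ; a smallest scale
    over the finitely many germs gives the contradiction. *)
Lemma clusters_exists e' : ~ cov e' -> exists e, ~ cov e /\ clusters e e'.
Proof.
move=> ne'; apply: contrapT => no.
have /choice [d dP] e : exists d : R, 0 < d /\ (~ cov e -> ~ exists t s : R,
    [/\ 0 < t < d, 0 < s < d & g0 (germ p' e t) = germ p' e' s]).
  have [ce|ne] := pselect (cov e); first by exists 1.
  apply: contrapT => h; apply: no; exists e; split=> // d d0.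
  by apply: contrapT => h'; apply: h; exists d; split.
have [c c0 cd] := finite_min (fun e => (dP e).1).
(* The bound 1/3 meets the requirement [d < 1 / 2] of [uncovered_cover]. *)
pose r := Num.min c (1 / 3).
have r0 : 0 < r by rewrite lt_min c0; lra.
have rc : r <= c by rewrite ge_min lexx.
have r3 : r <= 1 / 3 by rewrite ge_min lexx orbT.
have [|n nP] := uncovered_cover r0; first by lra.
have [u [u0 u2 nu]] := uncovered_germ ps pT sC innerC n.+1 ne'.
pose s := Num.min u r / 2.
have m0 : 0 < Num.min u r by rewrite lt_min u0.
have mu : Num.min u r <= u by rewrite ge_min lexx.
have mr : Num.min u r <= r by rewrite ge_min lexx orbT.
have s0 : 0 < s by rewrite /s; lra.
have su : s < u by rewrite /s; lra.
have sr : s < r by rewrite /s; lra.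
have nCs := nu s s0 su.
have [l lP] : ev (fun n => forall t, s <= t <= s -> C n (germ p e' t)).
  by apply: (germ_inner_covered innerC); lra.
have [x Cx xE] : exists2 x, C l x & f x = germ p e' s.
  have [z Cz zE] := lP l.+1 (leqnSn _) s (ltac:(lra)).
  by exists (iter l f z) => //; exists z.
have [y [ny yx]] := pi_lift Cx.
have [||e [t [ne t01 yE]]] := nP y => //.
  by move=> [_ Cy]; apply: nCs; rewrite -xE -yx; exact: iterate_succ.
have [_ /(_ ne)] := dP e; apply; exists t, s; split.
- by have := cd e; lra.
- by have := cd e; lra.
rewrite -yE; have [ng ge] := g0P ny; apply: pi_inj => //.
  by apply: inner_not_tip; case: e'.2; lra.
by rewrite ge yx xE pi_germ //; lra.
Qed.

Lemma germ_not_tip e (t : R) : 0 < t < 1 -> ~ tips (germ p' e t).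
Proof. by move=> t01; apply: inner_not_tip; case: e.2; lra. Qed.

Lemma clusters_base e e' : clusters e e' -> f (germ p e 0) = germ p e' 0.
Proof.
move=> ac; apply: hX => P Q nP nQ.
have cfe : continuous (f \o germ p e).
  move=> t; apply: continuous_comp; last exact: cf.
  exact: (germ_continuous ps).
have [d1 d10 h1] := near_right (cfe 0 _ nP).
have [d2 d20 h2] := near_right (@germ_continuous _ _ _ _ _ _ ps e' 0 _ nQ).
have [t [s [t0 s0 e1]]] := ac (Num.min (Num.min d1 d2) (1 / 2))
  (ltac:(rewrite !lt_min d10 d20; lra)).
move: t0 s0; rewrite !lt_min => /andP[t0 /andP[/andP[t1 t2] t3]].
move=> /andP[s0 /andP[/andP[s1 s2] s3]].
exists (f (germ p e t)); split; first by apply: h1 => //; exact: ltW.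
have ng : ~ tips (germ p' e t) by apply: germ_not_tip; lra.
have [_] := g0P ng; rewrite e1 !pi_germ; [|lra|lra].
by move=> <-; apply: h2 => //; exact: ltW.
Qed.

(** The image of a short punctured germ is connected, misses the tip of [e'] because [g0] preserves
    non-tips, and misses parameter [r] because [f] has the base of [e'] as limit. Clustering puts
    one of its points in between, and the gap lemma confines it there. *)
Lemma clusters_tends e e' : ~ cov e' -> clusters e e' -> tends e e'.
Proof.
move=> ne' ac r r0 r1.
have base := clusters_base ac.
have ne0 : germ p e' r <> germ p e' 0.
  move=> /(germ_inj_inner ps) [||_]; [lra|lra|].
  by case: e'.2 => /=; lra.
have cfe : continuous (f \o germ p e).
  move=> t; apply: continuous_comp; last exact: cf.
  exact: (germ_continuous ps).
have [d d0 dP] : exists2 d : R, 0 < d & forall t, 0 <= t -> t < d ->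
    f (germ p e t) <> germ p e' r.
  apply: (@near_right R (fun t => f (germ p e t) <> germ p e' r)).
  apply: (cfe 0 (~` [set germ p e' r])); apply: open_nbhs_nbhs; split.
    by apply: closed_openC; exact: arc_closed1.
  by rewrite /= base => e1; exact: ne0.
pose c := Num.min d 1.
have cd : c <= d by rewrite ge_min lexx.
have c1 : c <= 1 by rewrite ge_min lexx orbT.
have c0 : 0 < c by rewrite lt_min d0 ltr01.
exists c => //.
pose S := (g0 \o germ p' e) @` [set t : R | 0 < t < c].
have cS : connected S.
  apply: connected_continuous_connected.
    by apply: convex_connected => x y z /=; lra.
  apply: continuous_in_subspaceT => t; rewrite inE /= => tI.
  apply: continuous_comp; first exact: (germ_continuous ps').
  by apply: lift_map_continuous; apply: germ_not_tip; lra.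
have [t [s [t0 s0 e1]]] := ac (Num.min c r) (ltac:(rewrite lt_min c0 r0; done)).
move: t0 s0; rewrite (lt_min t) (lt_min s) => /andP[t0 /andP[t1 t2]].
move=> /andP[s0 /andP[s1 s2]].
have nS0 : ~ S (germ p' e' 0).
  move=> [x /= xI xE]; have ng : ~ tips (germ p' e x) by apply: germ_not_tip; lra.
  by have [] := g0P ng; rewrite xE => h; case: h; exists e'.
have nSr : ~ S (germ p' e' r).
  move=> [x /= xI xE]; have ng : ~ tips (germ p' e x) by apply: germ_not_tip; lra.
  have [_] := g0P ng; rewrite xE !pi_germ; [|lra|lra].
  by move=> /esym; apply: dP; lra.
have n0 : S `&` germ p' e' @` [set q : R | 0 < q < r] !=set0.
  exists (germ p' e' s); split; last by exists s => //=; rewrite s0 s2.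
  by exists t; [rewrite /= t0 t1|exact: e1].
have sub := germ_gap ps' pT' cS (lexx 0) (ltW r1) nS0 nSr n0.
move=> x x0 xc; have [|q /= /andP[q0 qr] qE] := sub (g0 (germ p' e x)).
  by exists x; rewrite /= ?x0 ?xc.
by exists q.
Qed.

Lemma tends_fun e e1 e2 : tends e e1 -> tends e e2 -> e1 = e2.
Proof.
(* Parameters below 1/2 distinguish the two ends of one arc. *)
move=> h1 h2; have [d1 d10 P1] := h1 (1 / 2) (ltac:(lra)) (ltac:(lra)).
have [d2 d20 P2] := h2 (1 / 2) (ltac:(lra)) (ltac:(lra)).
pose t := Num.min d1 d2 / 2.
have m0 : 0 < Num.min d1 d2 by rewrite lt_min d10.
have m1 : Num.min d1 d2 <= d1 by rewrite ge_min lexx.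
have m2 : Num.min d1 d2 <= d2 by rewrite ge_min lexx orbT.
have [||s1 [s10 s12 E1]] := P1 t; [rewrite /t; lra|rewrite /t; lra|].
have [||s2 [s20 s22 E2]] := P2 t; [rewrite /t; lra|rewrite /t; lra|].
move: E2; rewrite E1 => /(germ_inj_inner ps') [||ea]; [lra|lra|].
move: ea; case: e1 {h1 P1 E1} => a1 b1; case: e2 {h2 P2} => a2 b2 /= ->.
by case: b1; case: b2 => // h; exfalso; lra.
Qed.

End LiftMap.

(** Each uncovered germ [e'] has an uncovered germ [sg e'] tending to it. A germ tends to at most
    one germ, so [sg] is injective, hence bijective on the finite set [E]. On tips [g] is its
    inverse [ta], which yields continuity and singleton preimages. *)
Lemma blow_up_map : exists g : X' -> X',
  [/\ continuous g, forall x, pi (g x) = f (pi x),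
      forall x, ~ tips x -> ~ tips (g x) &
      forall x, tips x -> exists2 y, tips y & g @^-1` [set x] = [set y]].
Proof.
have [g0 g0P] := lift_map_exists.
pose E := {e : A * bool | ~~ `[< cov e >]}.
have nE (e : E) : ~ cov (val e) by case: e => e /= /asboolPn.
have /choice [sg sgP] (e' : E) : exists e : E, tends g0 (val e) (val e') /\
    f (germ p (val e) 0) = germ p (val e') 0.
  have [e [ne ac]] := clusters_exists g0P (nE e').
  have h : ~~ `[< cov e >] by apply/asboolPn.
  exists (exist _ e h); split; last exact: (clusters_base g0P).
  exact: (clusters_tends g0P (nE e')).
have sg_inj : injective sg.
  move=> e1 e2 h; apply/val_inj; apply: (@tends_fun g0 (val (sg e1))).
    by have [] := sgP e1.
  by rewrite h; have [] := sgP e2.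
have [ta sgK taK] := injF_bij sg_inj.
have tipE (e : E) : tips (tip (val e)) by exists (val e).
have tipsE x : tips x -> exists e : E, x = tip (val e).
  move=> [e [ne ->]]; have h : ~~ `[< cov e >] by apply/asboolPn.
  by exists (exist _ e h).
have tipE_inj (e e' : E) : tip (val e) = tip (val e') -> e = e'.
  by move=> h; apply/val_inj; apply: tip_inj => //; exact: nE.
have /choice [g gP] x : exists y, (~ tips x -> y = g0 x) /\
    forall e : E, x = tip (val e) -> y = tip (val (ta e)).
  have [/tipsE [e xe]|nx] := pselect (tips x); last first.
    by exists (g0 x); split=> // e xe; case: nx; rewrite xe.
  exists (tip (val (ta e))); split; first by rewrite xe => /(_ (tipE e)).
  by move=> e'; rewrite xe => /tipE_inj ->.
have gL x : ~ tips x -> g x = g0 x by have [] := gP x.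
have gT (e : E) : g (tip (val e)) = tip (val (ta e)).
  by have [_ /(_ e erefl)] := gP (tip (val e)).
have gnt x : ~ tips x -> ~ tips (g x).
  by move=> nx; rewrite gL //; have [] := g0P x nx.
exists g; split=> //.
- move=> x; have [/tipsE [e ->]|nx] := pselect (tips x); last first.
    move=> P nP; have [n nn] := ev_ex (lifted_nbhs nx).
    have nP0 : nbhs (g0 x) P by rewrite -gL.
    apply: filterS (filterI nn (lift_map_continuous g0P nx nP0)) => y [[ny _] Py].
    by rewrite /= gL.
  rewrite /continuous_at gT => P nP.
  have [r r0 rP] := near_right (@germ_continuous _ _ _ _ _ _ ps' (val (ta e)) 0 _ nP).
  have q0 : 0 < Num.min r (1 / 2) by rewrite lt_min r0; lra.
  have q1 : Num.min r (1 / 2) < 1 by rewrite gt_min; apply/orP; right; lra.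
  have [d d0] := (sgP (ta e)).1 _ q0 q1; rewrite taK => dP.
  have m0 : 0 < Num.min d (1 / 2) by rewrite lt_min d0; lra.
  have [|O [oO Oe OP]] := vertex_nbhd hX' ps' pT' (val e) (u := fun=> Num.min d (1 / 2)).
    by [].
  apply: (filterS _ (open_nbhs_nbhs (conj oO Oe))) => y /OP [e1 [t [ve t01 tm yE]]].
  have ee := blown_uncovered_eq (nE e) ve; subst e1.
  have [t0|t0] := eqVneq t 0.
    rewrite yE t0 /= -/(tip (val e)) gT; apply: rP => //; exact: lexx.
  have t_gt0 : 0 < t by rewrite lt_def t0; case/andP: t01.
  move: tm; rewrite lt_min => /andP[td t2].
  have [s [s0 sr gs]] := dP t t_gt0 td.
  rewrite /= yE gL; last by apply: germ_not_tip; rewrite t_gt0 (lt_trans t2) //; lra.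
  rewrite gs; apply: rP; first exact: ltW.
  by move: sr; rewrite lt_min => /andP[].
- move=> x; have [/tipsE [e ->]|nx] := pselect (tips x); last first.
    by rewrite gL //; have [] := g0P x nx.
  rewrite gT /tip !pi_germ ?lexx ?ler01 //.
  by have [_] := sgP (ta e); rewrite taK.
move=> x /tipsE [e ->]; exists (tip (val (sg e))); first exact: tipE.
apply/seteqP; split=> y /=; last by move=> ->; rewrite gT sgK.
have [/tipsE [e' ->]|ny] := pselect (tips y).
  by rewrite gT => /tipE_inj <-; rewrite taK.
by move=> h; case: (gnt y ny); rewrite h; exact: tipE.
Qed.

Lemma open_has_subarc (U : set X') : open U -> U !=set0 ->
  exists a (s t : R), [/\ 0 < s, s < t, t < 1 &
    p' a @` [set r : R | s < r < t] `<=` U].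
Proof.
move=> oU [x Ux]; have [[a [t [t01 xE]]]|[e xE]] := arc_point_cases pT' x.
  have : nbhs t (p' a @^-1` U).
    apply: (arc_cont ps' a t); apply: open_nbhs_nbhs; split=> //=.
    by rewrite -xE.
  move=> /nbhs_ballP [d /= d0 dU].
  exists a, t, (Num.min (t + d) ((t + 1) / 2)).
  have m1 : Num.min (t + d) ((t + 1) / 2) <= t + d by rewrite ge_min lexx.
  have m2 : Num.min (t + d) ((t + 1) / 2) <= (t + 1) / 2 by rewrite ge_min lexx orbT.
  have m0 : t < Num.min (t + d) ((t + 1) / 2) by rewrite lt_min; lra.
  split; [lra|lra|lra|move=> _ [r /= rI <-]; apply: dU].
  by rewrite /ball /= ltr_norml; lra.
have : nbhs (0 : R) (germ p' e @^-1` U).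
  apply: (germ_continuous ps' (e := e)); apply: open_nbhs_nbhs; split=> //=.
  by rewrite -xE.
move=> /near_right [d d0 dU]; pose c := Num.min d 1.
have c0 : 0 < c by rewrite lt_min d0 ltr01.
have cd : c <= d by rewrite ge_min lexx.
have c1 : c <= 1 by rewrite ge_min lexx orbT.
case: e xE dU => a [] xE dU.
  exists a, (1 - c / 2), (1 - c / 4); split; [lra|lra|lra|].
  move=> _ [r /= rI <-]; have := dU (1 - r).
  by rewrite /germ /= subKr; apply; lra.
exists a, (c / 4), (c / 2); split; [lra|lra|lra|].
by move=> _ [r /= rI <-]; apply: dU; lra.
Qed.

(** By compactness [pi] is a closed bijection of [lifted n] onto [C n], so it carries a clopen part
    to a clopen part. *)
Lemma lifted_connected n : connected (lifted n).
Proof.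
move=> B B0 [O oO BO] [F cF BF].
have pi_closed D : closed D -> closed (pi @` (lifted n `&` D)).
  move=> cD; apply: compact_closed => //; apply: continuous_compact.
    exact: continuous_subspaceT.
  by apply: compact_closedI => //; exact: lifted_compact.
have e1 : pi @` B = C n `&` pi @` (lifted n `&` F).
  rewrite -BF; apply/seteqP; split=> x; last by case.
  by move=> Bx; split=> //; move: Bx => [y]; rewrite BF => -[[_ Cy] _] <-.
have e2 : pi @` B = C n `&` ~` (pi @` (lifted n `&` ~` O)).
  apply/seteqP; split=> x.
    move=> [y By <-]; move: By; rewrite BO => -[[ny Cy] Oy]; split=> //.
    by move=> [z [[nz _] nO]] /(pi_inj nz ny) zy; apply: nO; rewrite zy.
  move=> [Cx nx]; have [y [ny yx]] := pi_lift Cx.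
  exists y => //; rewrite BO; split; first by split; rewrite ?yx.
  by apply: contrapT => nO; apply: nx; exists y => //; split=> //; split; rewrite ?yx.
have piB : pi @` B = C n.
  apply: (@spr_conn _ _ C sC n).
  - by have [y By] := B0; exists (pi y); exists y.
  - exists (~` (pi @` (lifted n `&` ~` O))) => //.
    exact/closed_openC/pi_closed/open_closedC.
  - by exists (pi @` (lifted n `&` F)) => //; exact: pi_closed.
apply/seteqP; split=> y; first by rewrite BO => -[].
move=> [ny Cy]; have : (pi @` B) (pi y) by rewrite piB.
move=> [z Bz]; have [nz _] : lifted n z by move: Bz; rewrite BO => -[].
by move/(pi_inj nz ny) => <-.
Qed.

(** One [lifted n] meets every arc at its middle, and an arc minus tips loses at most its ends. The
    empty [D] gives the connectedness of [X']. *)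
Lemma tips_removed_connected (D : set X') : D `<=` tips -> connected (~` D).
Proof.
move=> Dt; have [n nP] : exists n, forall a, lifted n (p' a (1 / 2)).
  apply: ev_ex; apply: ev_forall => a.
  have [|||N NP] := @innerC a (1 / 2) (1 / 2); [lra|lra|lra|].
  exists N => m /NP sub; split; first by apply: inner_not_tip; lra.
  by rewrite piE; [apply: sub; exists (1 / 2) => //=; lra|lra].
pose Y a := lifted n `|` p' a @` [set t : R | 0 <= t <= 1 /\ ~ D (p' a t)].
have -> : ~` D = \bigcup_(a in [set: A]) Y a.
  apply/seteqP; split=> x.
    have [a [t [t01 ->]]] := arcP pT' x => nD.
    by exists a => //; right; exists t.
  by move=> [a _ [[nx _] /Dt //|[t [_ nD] <-]]].
apply: bigcup_connected.
  by exists (p' a0 (1 / 2)) => a _; left; exact: nP.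
move=> a _; apply: connectedU; last first.
- apply: connected_image; first exact: (arc_cont ps').
  apply: convex_connected => x y z /= [x01 nx] [y01 ny] zI; split; first by lra.
  have [->//|zx] := eqVneq z x; have [->//|zy] := eqVneq z y.
  move=> /Dt; apply: inner_not_tip.
  by move: zI; rewrite !le_eqVlt eq_sym (negbTE zx) (negbTE zy) /=; lra.
- exact: lifted_connected.
exists (p' a (1 / 2)); split; first exact: nP.
exists (1 / 2) => //; split; first by lra.
by move=> /Dt; apply: inner_not_tip; lra.
Qed.

(** * Pure mixing and inaccessible points of the lift *)

Section Conclusion.
Context (mf : mixing f) (nexact : ~ exact_map f) (gC0 : is_graph C0).
Context (g : X' -> X') (cg : continuous g)
  (gpi : forall x, pi (g x) = f (pi x))
  (gnt : forall x, ~ tips x -> ~ tips (g x)).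

Lemma iter_pi n x : pi (iter n g x) = iter n f (pi x).
Proof. by elim: n => //= n <-. Qed.

Lemma iter_not_tip n x : ~ tips x -> ~ tips (iter n g x).
Proof. by elim: n => //= n IH /IH /gnt. Qed.

Lemma pi_surj x : exists y, pi y = x.
Proof.
have [a [t [t01 ->]]] := arcP pT x.
by exists (p' a t); rewrite piE.
Qed.

(** Mixing can be tested on open subarcs, which contain no tips; exactness of [g] would descend to
    [f] along the surjection [pi]. *)
Lemma pure_mixing_lift : pure_mixing g.
Proof.
split.
  move=> U V oU oV U0 V0.
  have [a [s [t [s0 st t1 UI]]]] := open_has_subarc oU U0.
  have [b [s' [t' [s'0 s't' t'1 VI]]]] := open_has_subarc oV V0.
  have ne c (x y : R) : x < y -> p c @` [set r : R | x < r < y] !=set0.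
    by move=> xy; exists (p c ((x + y) / 2)); exists ((x + y) / 2) => //=; lra.
  have [||N N0 NP] := mf _ _ (ne a s t st) (ne b s' t' s't').
  - by apply: (open_subarc hX ps pT); lra.
  - by apply: (open_subarc hX ps pT); lra.
  exists N => // n /NP [x [[y [r /= rI <-] yx] [r' /= r'I xE]]].
  exists (iter n g (p' a r)); split.
    by exists (p' a r) => //; apply: UI; exists r.
  apply: VI; exists r' => //; apply: pi_inj.
  - by apply: inner_not_tip; lra.
  - by apply: iter_not_tip; apply: inner_not_tip; lra.
  by rewrite iter_pi !piE ?xE ?yx //; lra.
move=> ex; apply: nexact => U oU [x Ux].
have [|n nP] := ex (pi @^-1` U) ((continuousP pi).1 cpi _ oU).
  by have [y yx] := pi_surj x; exists y; rewrite /preimage /= yx.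
exists n; apply/seteqP; split=> // y _; have [y' <-] := pi_surj y.
have : (iter n g @` (pi @^-1` U)) y' by rewrite nP.
by move=> [z Uz <-]; rewrite iter_pi; exists (pi z).
Qed.

Lemma inaccessible_lift : inaccessible g = tips.
Proof.
apply/seteqP; split=> x; last first.
  (* Any inner subarc is a suitable test subgraph: it has no tips, so its iterates never contain
     one. *)
  move=> tx; move/(_ (subarc p' a0 (1 / 3) (2 / 3))) => h.
  have [|k _ /interior_subset [_ [r /= rI <-] e]] := h.
    by apply: (subarc_graph ps'); lra.
  have : ~ tips (iter k g (p' a0 r)).
    by apply: iter_not_tip; apply: inner_not_tip; lra.
  by rewrite e.
move=> ix; apply: contrapT => nx; apply: ix => J gJ.
have [_ cJ _] := gJ; have [y [z [Jy Jz yz]]] := graph_nondegenerate gJ.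
have [a [s [t [s0 st t1 sub]]]] := connected_subarc hX' ps' pT' cJ Jy Jz yz.
have [|m mP] := ev_ex (absC (@subarc_connected _ _ _ _ _ _ ps a s t) _).
  by apply: (subarc_nondegenerate ps) => //; exact: ltW.
have [n nn] := ev_ex (lifted_nbhs nx).
exists (n + m)%N => //; apply: filterS nn => w [nw [c C0c cw]].
have [_ [r /= rI <-] e] := mP _ C0c.
exists (p' a r); first by apply: sub; exists r.
have nr : ~ tips (p' a r) by apply: inner_not_tip; lra.
apply: pi_inj => //; first exact: iter_not_tip.
by rewrite iter_pi -cw -e -iterD piE //; lra.
Qed.

Lemma inaccessible_base : pi @` inaccessible g = inaccessible f.
Proof.
rewrite inaccessible_lift; apply/seteqP; split=> x.
  move=> [_ [e [ne ->]] <-]; rewrite /tip pi_germ ?lexx ?ler01 //.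
  (* [C0] is the test subgraph: no [C k] is a neighbourhood of the start of an uncovered germ. *)
  move=> /(_ C0 gC0) [k _ ik].
  have [u [u0 u2 nu]] := uncovered_germ ps pT sC innerC k ne.
  have [d d0 dP] := near_right (@germ_continuous _ _ _ _ _ _ ps e 0 _ ik).
  have m0 : 0 < Num.min d u by rewrite lt_min d0.
  have md : Num.min d u <= d by rewrite ge_min lexx.
  have mu : Num.min d u <= u by rewrite ge_min lexx orbT.
  by apply: (nu (Num.min d u / 2)); [lra|lra|apply: dP; lra].
move=> ix; apply: contrapT => nx; apply: ix => J gJ.
have [_ cJ _] := gJ.
have [m mP] := ev_ex (absC cJ (graph_nondegenerate gJ)).
suff [n nn] : exists n, nbhs x (C n).
  exists (n + m)%N => //; apply: filterS nn => w [c /mP [z Jz <-] <-].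
  by exists z => //; rewrite iterD.
have [[a [t [t01 ->]]]|[e xE]] := arc_point_cases pT x.
  have [|||N NP] := @innerC a (t / 2) ((1 + t) / 2); [lra|lra|lra|].
  exists N; have sub := NP N (leqnn N); rewrite nbhsE.
  exists (p a @` [set r : R | t / 2 < r < (1 + t) / 2]).
    split; last by exists t => //=; lra.
    by apply: (open_subarc hX ps pT); lra.
  by move=> _ [r /= rst <-]; apply: sub; exists r => //=; lra.
have [|O [oO Ox OP]] := vertex_nbhd hX ps pT e (u := fun=> 1 / 2).
  by move=> _; lra.
have [n Cn] := ev_ex covered_germs; exists n; rewrite nbhsE; exists O.
  by rewrite xE.
move=> y /OP [e' [t [ve' t01 t2 ->]]].
(* A vertex that is not the image of a tip has only covered germs. *)
have ce' : cov e'.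
  apply: contrapT => ne'; apply: nx; exists (tip e'); first by exists e'.
  rewrite /tip pi_germ ?lexx ?ler01 // xE !germ0; exact: (arc_vertex ps).
by apply: Cn => //; case/andP: t01 => -> _ /=; exact: ltW.
Qed.

End Conclusion.

Context (bip : forall a b, v a false != v b true).
Context (simp : forall a b, v a false = v b false -> v a true = v b true -> a = b).

Lemma blown_bipartite a b : v' a false != v' b true.
Proof.
apply/eqP; rewrite /blown_vertex; case: ifP => _; case: ifP => _ // [] // e.
by have := bip a b; rewrite e eqxx.
Qed.

Lemma blown_simple a b : v' a false = v' b false -> v' a true = v' b true -> a = b.
Proof.
rewrite /blown_vertex; case: ifP => _; case: ifP => _ // [e1]; last by [].
by case: ifP => _; case: ifP => _ // [e2]; [exact: simp|].
Qed.

Lemma tip_endpoint x : tips x -> endpoint [set: X'] x.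
Proof.
move=> [e [ne ->]]; rewrite -pT'.
apply: (arc_endpoint ps' blown_bipartite blown_simple a0) => e'.
exact: blown_uncovered_eq.
Qed.

End BlowUp.

(** * Trimming and disconnecting numbers *)

Section Trimming.
Context (R : realType) (X : metricType R).
Context (A W : finType) (v : A -> bool -> W) (p : A -> R -> X).
Context (ps : arc_system v p) (c : A -> bool -> bool).

(* The ends [(a, i)] with [c a i = false] are cut off, which realises the
   blown-up graph inside [X]. *)
Definition trim (a : A) (t : R) : R :=
  let lo := if c a false then 0 else 1 / 3 in
  let hi := if c a true then 1 else 2 / 3 in
  lo + clamp t * (hi - lo).

Definition trimmed_arc (a : A) (t : R) : X := p a (trim a t).

Lemma trim01 a t : 0 <= trim a t <= 1.
Proof.
have := clamp01 t; rewrite /trim.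
by case: (c a false); case: (c a true) => /= h; nra.
Qed.

Lemma trim_inj a t s : 0 <= t <= 1 -> 0 <= s <= 1 -> trim a t = trim a s -> t = s.
Proof.
move=> t01 s01; rewrite /trim !clamp_id //.
by case: (c a false); case: (c a true) => /= h; nra.
Qed.

Lemma trim_end a (t : R) (i : bool) : 0 <= t <= 1 ->
  trim a t = i%:R -> c a i /\ t = i%:R.
Proof.
move=> t01; rewrite /trim clamp_id //.
case: i => /=; case: (c a false); case: (c a true) => /= h;
  by split=> //; nra.
Qed.

Lemma trim_covered a i : c a i -> trim a i%:R = i%:R.
Proof.
rewrite /trim clamp_id; last by case: i; rewrite lexx ler01.
by case: i => /= ->; case: (c a _) => /=; lra.
Qed.

Lemma trimmed_arc_system :
  arc_system (fun a i => if c a i then inl (v a i) else inr (a, i)) trimmed_arc.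
Proof.
split.
- move=> a; apply: (@continuous_within_comp _ _ _ [set: R] (trim a) (p a)) => //.
    move=> t; apply: cvgD; first exact: cvg_cst.
    by apply: cvgM; [exact: clamp_continuous|exact: cvg_cst].
  exact/continuous_subspaceT/(arc_cont ps).
- move=> a b i j; rewrite /trimmed_arc.
  case: ifP => ci; case: ifP => cj // [].
    by move=> vij; rewrite !trim_covered //; exact: (arc_vertex ps).
  by move=> -> ->.
move=> a b t s t01 s01 /(arc_inj ps (trim01 _ _) (trim01 _ _)).
case=> [[<- /(trim_inj t01 s01) ->]|[i [j [e1 e2 vij]]]]; first by left.
have [ci ti] := trim_end t01 e1; have [cj sj] := trim_end s01 e2.
by right; exists i, j; split=> //; rewrite ci cj vij.
Qed.

End Trimming.

Section SubmetricArcs.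
Context (R : realType) (X : metricType R).
Context (A W : finType) (v : A -> bool -> W) (q : A -> R -> X).
Context (qs : arc_system v q) (qB : forall a t, q a t \in arc_union q).

Let S := submetric (arc_union q).

Definition sub_arc (a : A) (t : R) : S := exist _ (q a t) (qB a t).

Lemma sub_arc_system : arc_system v sub_arc.
Proof.
split.
- by move=> a; apply: submetric_lift_continuous; exact: (arc_cont qs).
- by move=> a b i j h; apply/val_inj => /=; exact: (arc_vertex qs).
by move=> a b t s t01 s01 /(congr1 val) /=; exact: (arc_inj qs).
Qed.

Lemma sub_arc_union : arc_union sub_arc = [set: S].
Proof.
apply/seteqP; split=> // x _; have := valP x; rewrite inE => -[a [t [t01 xE]]].
by exists a, t; split=> //; apply/val_inj.
Qed.

End SubmetricArcs.

(** The bound [N] from [disconnects_bound] is common to all subgraphs, so the maximum exists; the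
    subgraph [B] forces it above [m]. *)
Lemma max_disconnecting_number_exists (R : realType) (X : metricType R)
    (A W : finType) (v : A -> bool -> W) (p : A -> R -> X) (B : set X) m :
  arc_system v p -> arc_union p = [set: X] -> is_graph B ->
  (forall n, (0 < n)%N -> (n <= m)%N -> exists2 D : set X,
     D `<=` B /\ D #= `I_n & connected (B `\` D)) ->
  exists2 L, max_disconnecting_number [set: X] L & (m < L)%N.
Proof.
move=> ps pT gB small; have hX := @metric_hausdorff _ X.
pose N := (3 * #|A|).+1.
have dN (J : set X) : is_graph J -> disconnects J N.
  by move=> [_ cJ _] D; exact: (disconnects_bound hX ps pT cJ).
have exmin (J : set X) : is_graph J -> exists n, disconnecting_number J n.
  move=> gJ; pose P n := (0 < n)%N && `[< disconnects J n >].
  have exP : exists n, P n by exists N; apply/andP; split=> //; apply/asboolP/dN.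
  have [n /andP[n0 /asboolP dn] nmin] := ex_minnP exP.
  by exists n; split=> // k k0 dk; apply: nmin; rewrite /P k0; apply/asboolP.
pose Q n := `[< exists J : set X, is_graph J /\ disconnecting_number J n >].
have exQ : exists n, Q n.
  by have [n dn] := exmin B gB; exists n; apply/asboolP; exists B.
have Qle n : Q n -> (n <= N)%N.
  by move=> /asboolP [J [gJ [_ _ nmin]]]; apply: nmin => //; exact: dN.
have [L /asboolP [J [gJ dJ]] Lmax] := ex_maxnP exQ Qle.
exists L; first split.
- by exists J; split.
- by move=> J' n _ gJ' dn; apply: Lmax; apply/asboolP; exists J'.
have [n dn] := exmin B gB.
have nL : (n <= L)%N by apply: Lmax; apply/asboolP; exists B.
apply: leq_trans nL; rewrite ltnNge; apply/negP => nm.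
have [n0 dis _] := dn; have [D [DB cD] conn] := small n n0 nm.
exact: (dis D DB cD conn).
Qed.

Theorem theorem6p1 (R : realType) (G : metricType R) (f : G -> G) :
  is_graph [set: G] -> continuous f -> pure_mixing f ->
  exists (G' : metricType R) (g : G' -> G') (pi : G' -> G),
    [/\ is_graph [set: G'], continuous g, pure_mixing g,
        continuous pi & set_surj [set: G'] [set: G] pi] /\
    (* (1) *)
    [/\ pi \o g = f \o pi,
        set_inj (~` inaccessible g) pi
      & pi @` inaccessible g = inaccessible f] /\
    (* (2) *)
    (forall e : G', inaccessible g e ->
       endpoint [set: G'] e /\
       exists2 e' : G', inaccessible g e' & g @^-1` [set e] = [set e']) /\
    (exists m L : nat,
       [/\ inaccessible g #= `I_m, max_disconnecting_number [set: G] L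
         & (m < L)%N]).
Proof.
move=> gG cf [mf nex].
have [A [W [v [p [C0 [[ps pT bip simp [a0 _]] [gC0 sC absC] innerC]]]]]] :=
  spreading_subdivision gG cf mf.
pose C n := iter n f @` C0.
pose c a i := `[< covered_germ p C (a, i) >].
(* With this [c] the vertices of the trimmed arcs agree with [blown_vertex] by conversion. *)
have qs := trimmed_arc_system ps c; set q := trimmed_arc p c in qs.
have qB a t : q a t \in arc_union q.
  rewrite inE; exists a, (clamp t); split; first exact: clamp01.
  by rewrite /q /trimmed_arc /trim (clamp_id (clamp01 t)).
pose G' := submetric (arc_union q); pose p' := sub_arc qB.
have ps' : arc_system (blown_vertex v p f C0) p' := sub_arc_system qs qB.
have pT' : arc_union p' = [set: G'] := sub_arc_union qB.
have [pi [cpi piE]] : exists pi : G' -> G, continuous pi /\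
    forall a (t : R), 0 <= t <= 1 -> pi (p' a t) = p a t.
  (* [pi] stretches every trimmed arc back to the full one; it differs from the inclusion [val],
     which serves to count the tips inside [G]. *)
  have [||pi [cpi piE]] := @glue_arcs R G' G _ _ _ p' p (@metric_hausdorff _ G') ps'
      (fun a => arc_cont ps a).
  - move=> a b i j; rewrite /blown_vertex; case: ifP => _; case: ifP => _ // [].
      exact: (arc_vertex ps).
    by move=> -> ->.
  - by exists (p a0 0).
  by exists pi; split=> //; apply/continuous_subspace_setT; rewrite -pT'.
have [g [cg gpi gnt gpre]] := blow_up_map ps pT cf sC innerC ps' pT' cpi piE.
have ig : inaccessible g = tips p f C0 p'.
  exact: (inaccessible_lift ps a0 absC innerC ps' pT' piE gpi gnt).
have conn D : D `<=` tips p f C0 p' -> connected (~` D).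
  exact: (tips_removed_connected ps pT a0 sC innerC ps' pT' cpi piE).
have cG' : connected (arc_union p') by rewrite pT' -setC0; exact: conn.
have bip' := blown_bipartite p f C0 bip.
have simp' := @blown_simple _ _ _ _ _ p f C0 simp.
have gG' : is_graph [set: G'] by rewrite -pT'; exact: (arc_union_graph ps').
have valT (D : set G') : val @` (~` D) = arc_union q `\` val @` D.
  apply/seteqP; split=> x.
    move=> [y nD <-]; split; first by have := valP y; rewrite inE.
    by move=> [z Dz /val_inj zy]; apply: nD; rewrite -zy.
  move=> [Bx nD]; have Bx' : x \in arc_union q by rewrite inE.
  by exists (exist _ x Bx') => // Dx; apply: nD; exists (exist _ x Bx').
have cval (D : set G') : connected D -> connected (val @` D).
  exact/connected_image/submetric_val_continuous.
have gB : is_graph (arc_union q).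
  apply: (arc_union_graph qs bip' simp' a0).
  have -> : arc_union q = val @` (~` (set0 : set G')).
    by rewrite valT image_set0 setD0.
  by apply: cval; exact: conn.
pose E := {e : A * bool | ~~ c e.1 e.2}.
have nE (e : E) : ~ covered_germ p C (val e).
  by case: e => -[a i] /= /asboolPn.
pose tipE (i : 'I_#|{: E}|) : G' := tip p' (val (enum_val i)).
have tipE_inj : injective tipE.
  move=> i j /(tip_inj ps') h; apply: enum_val_inj; apply/val_inj.
  by apply: h; exact: nE.
have tipE_range : range tipE = tips p f C0 p'.
  apply/seteqP; split=> x.
    by move=> [i _ <-]; exists (val (enum_val i)); split=> //; exact: nE.
  move=> [[a i] [ne ->]]; have h : ~~ c (a, i).1 (a, i).2 by apply/asboolPn.
  by exists (enum_rank (exist _ (a, i) h : E)); rewrite // /tipE enum_rankK.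
(* Any [n] tips, seen in [G] through [val], form a set whose removal leaves the trimmed subgraph
   connected. *)
have small n : (0 < n)%N -> (n <= #|{: E}|)%N -> exists2 D : set G,
    D `<=` arc_union q /\ D #= `I_n & connected (arc_union q `\` D).
  move=> _ nm; pose h (i : 'I_n) := tipE (widen_ord nm i).
  have hi : injective (val \o h).
    move=> i j /val_inj/tipE_inj e; apply: ord_inj.
    exact: (congr1 (@nat_of_ord _) e).
  exists (range (val \o h)); first split.
  - by move=> _ [i _ <-] /=; have := valP (h i); rewrite inE.
  - exact: card_range.
  have -> : range (val \o h) = val @` range h by rewrite image_comp.
  rewrite -valT; apply: cval; apply: conn => _ [i _ <-].
  by rewrite -tipE_range; exists (widen_ord nm i).
have [L maxL mL] := max_disconnecting_number_exists ps pT gB small.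
exists G', g, pi; split; [split=> //|split; [split|split]].
- exact: (pure_mixing_lift ps pT ps' pT' cpi piE mf nex gpi gnt).
- by move=> x _; have [y <-] := pi_surj pT piE x; exists y.
- by apply/funext => x /=; exact: gpi.
- move=> x y; rewrite !inE /= ig => nx ny.
  exact: (pi_inj ps ps' pT' piE).
- exact: (inaccessible_base ps pT a0 sC absC innerC ps' pT' piE gC0 gpi gnt).
- move=> e; rewrite ig => te; split; last exact: gpre.
  exact: (tip_endpoint a0 ps' pT' bip simp).
by exists #|{: E}|, L; split=> //; rewrite ig -tipE_range; exact: card_range.
Qed.
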